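(* With $q=0.288$, for any Borel set $E\subseteq[-\frac12,\frac12]$ symmetric with respect to the origin (i.e. $-E=E$), and any $T_o$-cylinder $F$, $$\mu_o(T_o^{-n}E\cap F)=\mu_o(E)\mu_o(F)+O_F(q^n),$$ i.e. for every $T_o$-cylinder $F$ there is a constant $C_F>0$ depending only on $F$ such that $|\mu_o(T_o^{-n}E\cap F)-\mu_o(E)\mu_o(F)|\le C_F\,q^n$ for all integers $n\ge1$ and all symmetric Borel sets $E\subseteq[-\frac12,\frac12]$.
   Context: Let $G=\frac{\sqrt5+1}{2}$. The map $T_o:[-\frac12,\frac12]\to[-\frac12,\frac12]$ is defined by $T_o(0)=0$ and $T_o(x)=\frac1x-\left\lfloor\frac1x+\frac12\right\rfloor$ for $x\neq0$. The measure $\mu_o$ on $[-\frac12,\frac12]$ is the ($T_o$-invariant) probability measure $d\mu_o=\frac{1}{2\log G}\left(\frac{1}{G+|x|}+\frac{1}{G+1-|x|}\right)dx$. $T_o^{-n}E$ denotes the preimage of $E$ under the $n$-th iterate of $T_o$. The $T_o$-cylinders are the sets $\Delta_{[b_1]}=\left\{\frac1{b_1+y}:y\in[-\frac12,\frac12]\right\}\cap[-\frac12,\frac12]$ for integers $b_1$ with $|b_1|\ge2$, and, for $r\ge2$ and integers $b_1,\dots,b_r$ with $|b_i|\ge2$ satisfying ($b_i=2\Rightarrow b_{i+1}\ge2$) and ($b_i=-2\Rightarrow b_{i+1}\le-2$), the sets $\Delta_{[b_1,\dots,b_r]}=\Delta_{[b_1]}\cap T_o^{-1}\Delta_{[b_2]}\cap\dots\cap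 T_o^{-(r-1)}\Delta_{[b_r]}$. *)

(* Defs.v *)
From HB Require Import structures.
From mathcomp Require Import all_boot all_order all_algebra.
From mathcomp Require Import ring lra.
From mathcomp Require Import all_classical all_reals all_analysis.
From mathcomp Require Import measurable_realfun.

Set Implicit Arguments.
Unset Strict Implicit.
Unset Printing Implicit Defensive.

Import Order.TTheory GRing.Theory Num.Theory.
Import numFieldNormedType.Exports.

Local Open Scope classical_set_scope.
Local Open Scope ring_scope.

Definition golden {R : realType} : R := (Num.sqrt 5 + 1) / 2.

Definition I_o {R : realType} : set R := `[- (1 / 2), 1 / 2].

(* T_o is extended to all of R by the same formula; every use below restricts
   the argument to I_o, which T_o maps into itself. *)
Definition T_o {R : realType} (x : R) : R :=
  if x == 0 then 0 else 1 / x - (Num.floor (1 / x + 1 / 2))%:~R.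

(* T_o^{-n} E for T_o viewed as a self-map of I_o. *)
Definition preim_T_o {R : realType} (n : nat) (E : set R) : set R :=
  I_o `&` iter n T_o @^-1` E.

Definition density_o {R : realType} (x : R) : R :=
  1 / (2 * ln golden) * (1 / (golden + `|x|) + 1 / (golden + 1 - `|x|)).

Definition mu_o {R : realType} (E : set R) : \bar R :=
  (\int[lebesgue_measure]_(x in E `&` I_o) (density_o x)%:E)%E.

Definition digit_cylinder {R : realType} (b : int) : set R :=
  [set 1 / (b%:~R + y) | y in I_o] `&` I_o.

Definition admissible (b : seq int) : bool :=
  [&& b != [::], all (fun c : int => 2 <= `|c|) b &
      sorted (fun c d : int =>
        ((c == 2) ==> (2 <= d)) && ((c == -2) ==> (d <= -2))) b].

(* Digits are numbered from 0, so the i-th digit is read after i iterates. *)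
Definition cylinder {R : realType} (b : seq int) : set R :=
  \bigcap_(i < size b) preim_T_o i (digit_cylinder b`_i).

Definition is_cylinder {R : realType} (F : set R) : Prop :=
  exists2 b : seq int, admissible b & F = cylinder b.

Section mu_o_probability.
Context {R : realType}.

Let mu := @lebesgue_measure R.
Let G : R := golden.

Lemma golden_gt1 : 1 < golden :> R.
Proof.
have : 1 < Num.sqrt 5 :> R by rewrite -[X in X < _]sqrtr1 ltr_sqrt ?ltr1n.
by rewrite /golden; lra.
Qed.

Let G_gt1 : 1 < G := golden_gt1.

Lemma golden_sqr : golden ^+ 2 = golden + 1 :> R.
Proof.
have : Num.sqrt 5 ^+ 2 = 5 :> R by rewrite sqr_sqrtr.
by rewrite /golden; nra.
Qed.

Lemma ln_golden_gt0 : 0 < ln golden :> R.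
Proof. exact: ln_gt0 golden_gt1. Qed.

Let I_oP (x : R) : I_o x -> 0 < G + `|x| /\ 0 < G + 1 - `|x|.
Proof.
rewrite /I_o /= in_itv/= => /andP[x1 x2].
have : `|x| <= 1 / 2 by rewrite ler_norml x2 andbT; lra.
have := normr_ge0 x; move: G_gt1; lra.
Qed.

Lemma density_o_ge0 (x : R) : I_o x -> 0 <= density_o x.
Proof.
move=> /I_oP[h1 h2]; rewrite /density_o mulr_ge0//.
  by rewrite divr_ge0// mulr_ge0// ltW// ln_golden_gt0.
by rewrite addr_ge0// divr_ge0// ltW.
Qed.

Lemma continuous_density_o : {within I_o, continuous (@density_o R)}.
Proof.
apply: continuous_in_subspaceT => x /set_mem/I_oP[h1 h2].
apply: cvgM; first exact: cvg_cst.
have cn : `|y| @[y --> x] --> `|x| by exact: norm_continuous.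
apply: cvgD; (apply: cvgM; first exact: cvg_cst);
  (apply: cvgV; first by rewrite gt_eqF).
  by apply: cvgD => //; exact: cvg_cst.
by apply: cvgB => //; exact: cvg_cst.
Qed.

Lemma measurable_I_o : measurable (@I_o R).
Proof. exact: measurable_itv. Qed.

Lemma measurable_density_o : measurable_fun I_o (@density_o R).
Proof.
apply: subspace_continuous_measurable_fun; first exact: measurable_I_o.
exact: continuous_density_o.
Qed.

Let mu_o0 : @mu_o R set0 = 0%E.
Proof. by rewrite /mu_o set0I integral_set0. Qed.

Let mu_o_ge0 (E : set R) : (0 <= mu_o E)%E.
Proof.
by apply: integral_ge0 => x [_ Ix]; rewrite lee_fin density_o_ge0.
Qed.

Let mu_o_sigma_additive : semi_sigma_additive (@mu_o R).
Proof.
move=> /= F mF tF mUF; rewrite /mu_o; apply: cvg_toP.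
  apply: ereal_nondecreasing_is_cvgn => m n mn.
  apply: lee_sum_nneg_natr => // k _ _.
  by apply: integral_ge0 => x [_ Ix]; rewrite lee_fin density_o_ge0.
rewrite setI_bigcupl ge0_integral_bigcup//=.
- by move=> k; exact: (measurableI _ _ (mF k) measurable_I_o).
- rewrite -setI_bigcupl; apply/measurable_EFinP.
  apply: measurable_funS measurable_density_o; first exact: measurable_I_o.
  exact: subIsetr.
- by move=> x [k _ [_ Ix]]; rewrite lee_fin density_o_ge0.
- exact: trivIset_setIr.
Qed.

HB.instance Definition _ := isMeasure.Build _ _ _ (@mu_o R)
  mu_o0 mu_o_ge0 mu_o_sigma_additive.

Let half_int : (\int[mu]_(x in `[0%R, (1 / 2)%R]) (density_o x)%:E
  = (1 / 2)%:E)%E.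
Proof.
pose c : R := 1 / (2 * ln G).
pose A (x : R) := c * (ln (G + x) - ln (G + 1 - x)).
have dA (x : R) : 0 <= x -> x <= 1 / 2 ->
    is_derive x 1 A (c * (1 / (G + x) + 1 / (G + 1 - x))).
  move=> x0 x1.
  have h1 : 0 < G + x by move: G_gt1; lra.
  have h2 : 0 < G + 1 - x by move: G_gt1; lra.
  have d1 : is_derive x (1 : R) (fun y => G + y) 1.
    by apply: is_derive_eq (is_deriveD (is_derive_cst G x 1)
      (is_derive_id x 1)) _; rewrite add0r.
  have d2 : is_derive x (1 : R) (fun y => G + 1 - y) (- 1).
    by apply: is_derive_eq (is_deriveB (is_derive_cst (G + 1) x 1)
      (is_derive_id x 1)) _; rewrite add0r.
  have l1 := @is_derive1_comp R (@ln R) (fun y => G + y) x _ _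
    (is_derive1_ln h1) d1.
  have l2 := @is_derive1_comp R (@ln R) (fun y => G + 1 - y) x _ _
    (is_derive1_ln h2) d2.
  apply: is_derive_eq (is_deriveZ c (is_deriveB l1 l2)) _.
  by rewrite /GRing.scale/= !div1r mulr1 mulrN1 opprK.
have half0 : (0 : R) < 1 / 2 by lra.
have cA (x : R) : 0 <= x -> x <= 1 / 2 -> {for x, continuous A}.
  move=> x0 x1; apply: differentiable_continuous.
  by apply/derivable1_diffP; have [] := dA _ x0 x1.
rewrite (@continuous_FTC2 R _ A)//.
- rewrite -EFinB; congr EFin.
  rewrite /A addr0 subr0.
  have -> : G + 1 - 1 / 2 = G + 1 / 2 by lra.
  rewrite subrr mulr0 sub0r -mulrN opprB -golden_sqr lnXn ?(lt_trans _ G_gt1)//.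
  rewrite mulr2n addrK /c.
  by have := ln_golden_gt0; rewrite -/G => h; field; rewrite gt_eqF.
- apply: continuous_subspaceW continuous_density_o.
  by rewrite /I_o => x /=; rewrite !in_itv/= => /andP[? ?];
    apply/andP; split; lra.
- split.
  + move=> x; rewrite in_itv/= => /andP[x0 x1].
    by have [] := dA x (ltW x0) (ltW x1).
  + by apply: cvg_at_right_filter; apply: cA; lra.
  + by apply: cvg_at_left_filter; apply: cA; lra.
- move=> x; rewrite in_itv/= => /andP[x0 x1].
  rewrite derive1E; have [_ ->] := dA x (ltW x0) (ltW x1).
  by rewrite /density_o ger0_norm// ltW.
Qed.

Let mu_o_setT : mu_o [set: R] = 1%E.
Proof.
have half0 : (0 : R) <= 1 / 2 by lra.
have IE : @I_o R = [set` `[- (1 / 2), 0[] `|` [set` `[0, 1 / 2]].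
  by rewrite /I_o -itv_bndbnd_setU ?bnd_simp//; lra.
rewrite /mu_o setTI IE.
have sub1 : [set` `[- (1 / 2), 0[] `<=` (@I_o R).
  by rewrite /I_o => x /=; rewrite !in_itv/= => /andP[? ?];
    apply/andP; split; lra.
rewrite ge0_integral_setU//=.
- rewrite half_int integral_itv_bndo_bndc; last first.
    apply/measurable_EFinP.
    by apply: measurable_funS measurable_density_o => //; exact: measurable_I_o.
  rewrite -[X in `[_, X]]oppr0 integration_by_substitution_oppr//; last first.
    apply: continuous_subspaceW continuous_density_o.
    by rewrite /I_o => x /=; rewrite !in_itv/= => /andP[? ?];
    apply/andP; split; lra.
  under eq_integral do rewrite /= /density_o normrN.
  by rewrite half_int -EFinD; congr EFin; lra.
- apply/measurable_EFinP.
  apply: measurable_funS measurable_density_o; first exact: measurable_I_o.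
  by rewrite IE.
- move=> x h; have Ix : I_o x by rewrite IE.
  by rewrite lee_fin density_o_ge0.
- apply/eqP; rewrite -subset0.
  move=> x [] /=; rewrite !in_itv/= => /andP[_ h1] /andP[h2 _].
  by move: (lt_le_trans h1 h2); rewrite ltxx.
Qed.

HB.instance Definition _ := @Measure_isProbability.Build _ _ R
  (@mu_o R) mu_o_setT.

End mu_o_probability.

Lemma T_o_I_o {R : realType} (x : R) : I_o (T_o x).
Proof.
rewrite /I_o /T_o /= in_itv/=; case: ifP => _; first by apply/andP; split; lra.
have := floor_le (1 / x + 1 / 2); have := floorD1_gt (1 / x + 1 / 2).
by rewrite intrD => h1 h2; apply/andP; split; lra.
Qed.

(* Main.v *)
(* On symmetric sets, [T_o] may be replaced by the folded map [|T_o|] of [0, 1/2],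
   whose inverse branches are [1 / (k + y)] with [k >= 2] and [1 / (k - y)] with
   [k >= 3]. Normalized by the density of [mu_o], its transfer operator averages
   [f] over these branches with explicit weights that telescope to 1; summing the
   variations of the weights and of the branches shows that it multiplies
   Lipschitz constants by at most 0.288. Iterating on a Lipschitz density [f],
   [n] steps leave a function whose oscillation is at most a constant times
   0.288 ^ n, whence the mixing estimate for measures with Lipschitz density. To
   avoid infinite series the operator is truncated to finitely many branches; the
   error tends to 0 for each [n].
   The restriction of [mu_o] to a cylinder is reduced to this case one digit at a
   time: on the cylinder of [k], [T_o] is inverted by [y |-> 1 / (k + y)], so the
   image of a measure with Lipschitz density is again of this form, carried by
   [-1/2, 1/2] or, for k = 2 and k = -2, by one half of it. *)
From HB Require Import structures.
Require Import Defs.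
From mathcomp Require Import all_boot all_order all_algebra.
From mathcomp Require Import ring lra.
From mathcomp Require Import all_classical all_reals all_analysis.
From mathcomp Require Import measurable_realfun.

Import Order.TTheory GRing.Theory Num.Theory.
Import numFieldNormedType.Exports.

Local Open Scope classical_set_scope.
Local Open Scope ring_scope.

Set Implicit Arguments.
Unset Strict Implicit.
Unset Printing Implicit Defensive.

(** * Lipschitz functions on sets of real numbers *)

Section lipschitz.
Context {R : realType}.
Notation mu := (@lebesgue_measure R).
Implicit Types (A B : set R) (f g : R -> R) (L a b : R).

Definition klip L A f := forall x y, A x -> A y -> `|f x - f y| <= L * `|x - y|.
Definition lip A f := exists2 L, 0 <= L & klip L A f.

Lemma eq_lip A f g : (forall x, A x -> f x = g x) -> lip A f -> lip A g.
Proof. by move=> fg [L L0 Lf]; exists L => // x y Ax Ay; rewrite -!fg//; exact: Lf. Qed.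

Lemma lipS A B f : A `<=` B -> lip B f -> lip A f.
Proof. by move=> AB [L L0 Lf]; exists L => // x y /AB + /AB; exact: Lf. Qed.

Lemma lip_cst A (c : R) : lip A (fun=> c).
Proof. by exists 0 => // x y _ _; rewrite subrr normr0 mul0r. Qed.

Lemma lip_id A : lip A id.
Proof. by exists 1 => // x y _ _; rewrite mul1r. Qed.

Lemma lipD A f g : lip A f -> lip A g -> lip A (fun x => f x + g x).
Proof.
move=> [L L0 Lf] [M M0 Mg]; exists (L + M) => [|x y Ax Ay]; first exact: addr_ge0.
rewrite opprD addrACA mulrDl; apply: le_trans (ler_normD _ _) _.
by apply: lerD; [exact: Lf|exact: Mg].
Qed.

Lemma lipN A f : lip A f -> lip A (fun x => - f x).
Proof. by move=> [L L0 Lf]; exists L => // x y Ax Ay; rewrite -opprD normrN Lf. Qed.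

Lemma lip_comp A B f (u : R -> R) : (forall x, A x -> B (u x)) ->
  lip A u -> lip B f -> lip A (fun x => f (u x)).
Proof.
move=> AB [M M0 Mu] [L L0 Lf]; exists (L * M) => [|x y Ax Ay]; first exact: mulr_ge0.
apply: le_trans (Lf _ _ (AB _ Ax) (AB _ Ay)) _.
by rewrite -mulrA ler_wpM2l// Mu.
Qed.

Lemma lip_bounded a b f : lip `[a, b] f ->
  exists2 M, 0 <= M & forall x, `[a, b]%classic x -> `|f x| <= M.
Proof.
move=> [L L0 Lf]; exists (`|f a| + L * `|b - a|) => [|x].
  by rewrite addr_ge0// mulr_ge0.
rewrite /= in_itv/= => /andP[ax xb]; rewrite -[f x](subrK (f a)) addrC.
apply: le_trans (ler_normD _ _) _; rewrite lerD2l.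
apply: le_trans (Lf _ _ _ _) _; rewrite /= ?in_itv/= ?ax ?xb ?lexx ?(le_trans ax xb)//.
by rewrite ler_wpM2l// !ger0_norm ?lerB ?subr_ge0// (le_trans ax xb).
Qed.

(** A product is Lipschitz only when the factors are bounded, which is why the domain here is a
    compact interval. *)
Lemma lipM a b f g : lip `[a, b] f -> lip `[a, b] g ->
  lip `[a, b] (fun x => f x * g x).
Proof.
move=> lf lg; have [F F0 Fb] := lip_bounded lf; have [G G0 Gb] := lip_bounded lg.
move: lf lg => [L L0 Lf] [M M0 Mg]; exists (L * G + F * M) => [|x y Ax Ay].
  by rewrite addr_ge0// mulr_ge0.
have -> : f x * g x - f y * g y = (f x - f y) * g x + f y * (g x - g y) by ring.
apply: le_trans (ler_normD _ _) _; rewrite !normrM mulrDl; apply: lerD.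
  by rewrite mulrAC ler_pM// ?Gb// Lf.
by rewrite -mulrA ler_pM// ?Fb// Mg.
Qed.

(** Since [1/u - 1/v = (v - u)/(u v)] and the values have modulus at least 1, the Lipschitz constant
    is kept. *)
Lemma lip_inv A f : (forall x, A x -> 1 <= `|f x|) -> lip A f ->
  lip A (fun x => (f x)^-1).
Proof.
move=> f1 [L L0 Lf]; exists L => // x y Ax Ay.
have f0 z : A z -> 0 < `|f z| by move=> /f1; exact: lt_le_trans.
have -> : (f x)^-1 - (f y)^-1 = (f y - f x) / (f x * f y).
  by field; rewrite -!normr_gt0 !f0.
rewrite normrM normfV normrM ler_pdivrMr; last by rewrite mulr_gt0 ?f0.
rewrite distrC; apply: le_trans (Lf _ _ Ax Ay) _.
by rewrite ler_peMr ?mulr_ge0// -[1]mulr1 ler_pM ?f1.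
Qed.

Lemma lip_continuous A f : lip A f -> {within A, continuous f}.
Proof.
move=> [L L0 Lf]; apply/subspace_continuousP => x Ax.
apply/cvgrPdist_le => e e0.
have xe : \forall y \near x, `|x - y| <= e / (L + 1).
  have : y @[y --> x] --> x by exact: cvg_id.
  by move=> /cvgrPdist_le; apply; rewrite divr_gt0// ltr_wpDl.
near=> y.
have Ay : A y by near: y; exact: withinT.
apply: le_trans (Lf _ _ Ax Ay) _.
apply: (@le_trans _ _ ((L + 1) * `|x - y|)); first by rewrite ler_wpM2r// lerDl.
rewrite mulrC -ler_pdivlMr; last by rewrite ltr_wpDl.
near: y; exact: cvg_within xe.
Unshelve. all: by end_near. Qed.

(** Lipschitz functions are continuous, hence integrable on compact intervals; this settles the
    integrability side conditions of all later integral manipulations. *)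
Lemma lip_integrable a b f (S : set R) :
  lip `[a, b] f -> measurable S -> S `<=` `[a, b] ->
  mu.-integrable S (EFin \o f).
Proof.
move=> /lip_continuous cf mS Sab; apply: (@integrableS _ _ _ mu `[a, b]%classic) => //.
by apply: continuous_compact_integrable => //; exact: segment_compact.
Qed.

Lemma lip_measurable a b f (S : set R) :
  lip `[a, b] f -> measurable S -> S `<=` `[a, b] -> measurable_fun S f.
Proof.
move=> lf mS Sab; apply/measurable_EFinP.
by have /integrableP[] := lip_integrable lf mS Sab.
Qed.

End lipschitz.

(** * Measures given by a nonnegative density *)

Section density_measure.
Local Open Scope ereal_scope.
Context {R : realType}.
Variables (D : set R) (f : R -> \bar R).
Hypotheses (mD : measurable D) (mf : measurable_fun D f).
Hypothesis f0 : forall x, D x -> 0 <= f x.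

(** The three proofs are arguments of the function, so that the measure structure can be attached to
    the term and inferred from it. *)
Definition density_measure of measurable D & measurable_fun D f &
    (forall x, D x -> 0 <= f x) :=
  fun A : set R => \int[@lebesgue_measure R]_(x in D `&` A) f x.

Local Notation nu := (density_measure mD mf f0).

Let nu0 : nu set0 = 0.
Proof. by rewrite /density_measure setI0 integral_set0. Qed.

Let nu_ge0 A : 0 <= nu A.
Proof. by apply: integral_ge0 => x [/f0]. Qed.

Let nu_sigma_additive : semi_sigma_additive nu.
Proof.
move=> /= F mF tF mUF; rewrite /density_measure; apply: cvg_toP.
  apply: ereal_nondecreasing_is_cvgn => m n mn.
  by apply: lee_sum_nneg_natr => // k _ _; apply: integral_ge0 => x [/f0].
rewrite setI_bigcupr ge0_integral_bigcup//=.
- by move=> k; apply: measurableI (mF k).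
- rewrite -setI_bigcupr; exact: measurable_funS mf.
- by move=> x [k _ [/f0]].
- exact: trivIset_setIl.
Qed.

HB.instance Definition _ := isMeasure.Build _ _ _ (density_measure mD mf f0)
  nu0 nu_ge0 nu_sigma_additive.

End density_measure.

(** * Change of variables along inversion and reflection *)

Section change_of_variables.
Context {R : realType}.
Notation mu := (@lebesgue_measure R).
Implicit Types (A K : set R) (a b c d k : R).

(* Both sides are finite measures in [A], so they agree as soon as they agree on
   the half-lines. *)
Lemma ge0_integral_preimage_itv (v : R -> R) K (g w : R -> \bar R) a b :
  measurable K -> measurable_fun setT v ->
  measurable_fun K g -> (forall x, K x -> (0 <= g x)%E) ->
  measurable_fun `[a, b] w -> (forall x, `[a, b]%classic x -> (0 <= w x)%E) ->
  (\int[mu]_(x in `[a, b]) w x < +oo)%E ->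
  (forall x, K x -> a <= v x <= b) ->
  (forall c, a <= c -> c <= b -> (
    \int[mu]_(x in K `&` v @^-1` `[c, b]) g x = \int[mu]_(x in `[c, b]) w x)%E) ->
  forall A, measurable A ->
  (\int[mu]_(x in K `&` v @^-1` A) g x = \int[mu]_(x in `[a, b] `&` A) w x)%E.
Proof.
move=> mK mv mg g0 mw w0 woo vK gw A mA.
have mI : measurable (`[a, b]%classic : set R) by exact: measurable_itv.
have eqG (x : R) : pushforward (density_measure mK mg g0) v `[x, +oo[ =
    density_measure mI mw w0 `[x, +oo[.
  rewrite /pushforward /density_measure.
  have [xb|bx] := leP x b; last first.
    rewrite [X in integral _ X _ = _](_ : _ = set0); last first.
      rewrite -subset0 => y [/vK/andP[_ +]] /=; rewrite in_itv/= andbT.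
      by move=> yb xy; move: (lt_le_trans bx (le_trans xy yb)); rewrite ltxx.
    rewrite [X in _ = integral _ X _](_ : _ = set0) ?integral_set0//.
    rewrite -subset0 => y [] /=; rewrite !in_itv/= andbT => /andP[_ yb xy].
    by move: (lt_le_trans bx (le_trans xy yb)); rewrite ltxx.
  have [ab|ba] := leP a b; last first.
    rewrite [X in integral _ X _ = _](_ : _ = set0); last first.
      rewrite -subset0 => y [/vK/andP[h1 h2]].
      by move: (lt_le_trans ba (le_trans h1 h2)); rewrite ltxx.
    by rewrite set_itv_ge ?set0I ?integral_set0// bnd_simp -ltNge.
  (* Both measures see the half-line from [x] only through [[max a x, b]], where the hypothesis on
     [c] applies. *)
  have := gw (Num.max a x); rewrite le_max lexx ge_max ab xb => /(_ isT isT).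
  congr (_ = _).
    congr (integral _ _ _); apply/seteqP; split => y /=; rewrite !in_itv/=.
      by rewrite andbT ge_max => -[Ky /andP[/andP[_ ->] _]].
    rewrite andbT => -[Ky xy]; split => //; have /andP[h1 h2] := vK _ Ky.
    by rewrite ge_max h1 h2 xy.
  congr (integral _ _ _); apply/seteqP; split => y /=; rewrite !in_itv/=.
    by rewrite andbT ge_max => /andP[/andP[-> ->] ->].
  by rewrite andbT ge_max => -[/andP[-> ->] ->].
have m2oo (n : nat) : (density_measure mI mw w0 `[(- n%:R)%R, +oo[ < +oo)%E.
  apply: le_lt_trans woo; apply: ge0_subset_integral => //.
  exact: measurableI.
suff : pushforward (density_measure mK mg g0) v A =
    density_measure mI mw w0 A by [].
apply: (measure_unique (@RGenCInfty.G R) (fun n => `[- n%:R, +oo[%classic)) => //.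
- exact: RGenCInfty.measurableE.
- move=> _ _ [x ->] [y ->]; exists (Num.max x y).
  by apply/seteqP; split => z /=; rewrite !in_itv/= !andbT ge_max;
    [move=> [-> ->]|move/andP].
- by move=> n; exists (- n%:R).
- apply/seteqP; split => // x _; exists (Num.truncn `|x|).+1 => //=.
  rewrite in_itv/= andbT lerNl; apply: le_trans (ltW (truncnS_gt _)).
  by rewrite -normrN ler_norm.
- by move=> _ [x ->]; exact: eqG.
- by move=> n; have := m2oo n; rewrite -eqG.
Qed.

Lemma measurable_inv : measurable_fun [set: R] (fun x : R => x^-1).
Proof.
rewrite -(setvU [set (0 : R)]); apply/measurable_funU => //.
  exact: measurableC.
split; last exact: measurable_fun_set1.
apply: open_continuous_measurable_fun; last first.
  by move=> x /set_mem /= /eqP x0; exact: inv_continuous.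
by rewrite openC; exact: closed_eq.
Qed.

(** The hypothesis keeps [k + y] on one side of 0 and of modulus at least 1 for all [y] in
    [[a, b]]. *)
Lemma lip_shift_inv k a b : 1 <= k + a \/ k + b <= -1 ->
  lip `[a, b] (fun y => (k + y)^-1).
Proof.
move=> k1; apply: lip_inv => [y|]; last by apply: lipD; [exact: lip_cst|exact: lip_id].
rewrite /= in_itv/= => /andP[ay yb]; case: k1 => k1.
  by rewrite ler_normr; apply/orP; left; lra.
by rewrite ler_normr; apply/orP; right; lra.
Qed.

Lemma shift_inv_itv k a b x : a <= b -> 0 < k + a \/ k + b < 0 ->
  (k + b)^-1 <= x <= (k + a)^-1 -> a <= x^-1 - k <= b.
Proof.
move=> ab k0 /andP[bx xa]; rewrite lerBrDl lerBlDl.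
case: k0 => k0.
  have x0 : 0 < x by apply: lt_le_trans bx; rewrite invr_gt0; lra.
  rewrite -[k + a]invrK -[k + b]invrK !lef_pV2 ?posrE ?invr_gt0 ?xa ?bx//; lra.
have x0 : x < 0 by apply: le_lt_trans xa _; rewrite invr_lt0; lra.
rewrite -[k + a]invrK -[k + b]invrK !lef_nV2 ?negrE ?invr_lt0 ?xa ?bx//; lra.
Qed.

(** This is the substitution [x = 1 / (k + y)], with Jacobian [1 / (k + y)^2], for an arbitrary
    measurable set in place of an interval. *)
Lemma ge0_integration_by_inversion (g : R -> R) k a b A :
  a <= b -> 1 <= k + a \/ k + b <= -1 ->
  lip `[(k + b)^-1, (k + a)^-1] g ->
  (forall x, (k + b)^-1 <= x -> x <= (k + a)^-1 -> 0 <= g x) ->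
  measurable A -> (
  \int[mu]_(x in `[((k + b)^-1)%R, ((k + a)^-1)%R] `&`
      (fun x : R => (x^-1 - k)%R) @^-1` A) (g x)%:E =
  \int[mu]_(y in `[a, b] `&` A) (g (k + y)^-1 / (k + y) ^+ 2)%R%:E)%E.
Proof.
move=> ab k1 lg g0 mA.
have k0 : 0 < k + a \/ k + b < 0 by case: k1 => ?; [left|right]; lra.
have kn0 (y : R) : a <= y -> y <= b -> k + y != 0.
  by move=> ay yb; apply/eqP => e; case: k0; lra.
have decr (x y : R) : a <= x -> x <= y -> y <= b -> (k + y)^-1 <= (k + x)^-1.
  move=> ax xy yb; case: k0 => k0.
    by rewrite lef_pV2 ?posrE; lra.
  by rewrite lef_nV2 ?negrE; lra.
have d (y : R) : k + y != 0 ->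
    is_derive y 1 (fun y => (k + y)^-1) (- (k + y) ^- 2).
  move=> ky.
  have d1 : is_derive y (1 : R) (fun y => k + y) 1.
    by apply: is_derive_eq (is_deriveD (is_derive_cst k y 1)
      (is_derive_id y 1)) _; rewrite add0r.
  apply: is_derive_eq (@is_deriveV _ _ _ _ _ _ d1) _; first exact: ky.
  by rewrite /GRing.scale/= mulr1.
have cV (y : R) : k + y != 0 -> (k + z)^-1 @[z --> y] --> (k + y)^-1.
  move=> ky; suff : {for y, continuous (fun z => (k + z)^-1)} by [].
  by apply: differentiable_continuous; apply/derivable1_diffP; have [] := d _ ky.
have dE (y : R) : k + y != 0 -> derive1 (fun y : R => (k + y)^-1) y = - (k + y)^- 2.
  by move=> ky; rewrite derive1E; have [_ ->] := d _ ky.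
have cdV (y : R) : k + y != 0 ->
    derive1 (fun y : R => (k + y)^-1) z @[z --> y] --> derive1 (fun y : R => (k + y)^-1) y.
  move=> ky; rewrite dE//.
  apply: (@cvg_trans _ ((fun z => - ((k + z)^-1 * (k + z)^-1)) @ y)).
    apply: near_eq_cvg.
    have : k + z @[z --> y] --> k + y by apply: cvgD; [exact: cvg_cst|exact: cvg_id].
    move=> /cvgr_neq0 /(_ ky); apply: filterS => z kz.
    by rewrite dE// -expr2 exprVn.
  by rewrite -exprVn expr2; have := cvgN (cvgM (cV _ ky) (cV _ ky)); apply.
have sub c : a <= c -> c <= b ->
    `[(k + b)^-1, (k + c)^-1] `<=` `[(k + b)^-1, (k + a)^-1].
  by move=> ac cb; apply: subset_itvl; rewrite bnd_simp; exact: decr.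
have lw : lip `[a, b] (fun y => g (k + y)^-1 / (k + y) ^+ 2).
  apply: lipM.
    apply: lip_comp (lip_shift_inv k1) lg => y.
    by rewrite /= !in_itv/= => /andP[ay yb]; rewrite !decr.
  apply: eq_lip (lipM (lip_shift_inv k1) (lip_shift_inv k1)) => y _.
  by rewrite -expr2 exprVn.
have img c (x : R) : a <= c -> c <= b ->
    (k + b)^-1 <= x <= (k + c)^-1 -> c <= x^-1 - k <= b.
  by move=> ac cb; apply: shift_inv_itv => //; case: k0 => ?; [left|right]; lra.
apply: ge0_integral_preimage_itv => //.
- by apply: measurable_funB => //; exact: measurable_inv.
- by apply/measurable_EFinP; exact: lip_measurable lg _ _.
- by move=> x /=; rewrite in_itv/= => /andP[? ?]; rewrite lee_fin g0.
- by apply/measurable_EFinP; exact: lip_measurable lw _ _.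
- move=> x /=; rewrite in_itv/= => /andP[? ?]; rewrite lee_fin.
  by rewrite mulr_ge0 ?invr_ge0 ?sqr_ge0// g0 ?decr//.
- by apply: integrable_lty => //; exact: lip_integrable lw _ _.
- by move=> x /=; rewrite in_itv/=; exact: img.
(* It remains to treat [[c, b]]: its preimage is again an interval, on which the substitution
   theorem for decreasing functions applies. *)
move=> c ac cb.
rewrite [X in integral _ X _ = _](_ : _ = `[(k + b)^-1, (k + c)^-1]%classic); last first.
  apply/seteqP; split => x /=; rewrite !in_itv/=.
    move=> [bxa /andP[cx _]]; move: (bxa) => /andP[-> _]/=.
    have /andP[ax xb] := img a x (lexx _) ab bxa.
    have := decr _ _ ac cx xb; rewrite [k + (_ - _)]addrC subrK invrK; exact.
  move=> bxc; rewrite img//; split => //; move: bxc => /andP[-> xc]/=.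
  by rewrite (le_trans xc)// decr.
rewrite (@integration_by_substitution_decreasing _ (fun y => (k + y)^-1) g c b cb).
- apply: eq_integral => y /set_mem /=; rewrite in_itv/= => /andP[cy yb].
  by rewrite !fctE/= dE ?opprK// kn0// (le_trans ac).
- move=> x y; rewrite !in_itv/= => /andP[cx xb] /andP[cy yb] xy.
  have ax := le_trans ac cx; have ay := le_trans ac cy.
  by case: k0 => k0; [rewrite ltf_pV2 ?posrE|rewrite ltf_nV2 ?negrE]; lra.
- move=> y; rewrite in_itv/= => /andP[cy yb]; apply: cdV.
  by rewrite kn0// ?(le_trans ac)// ltW.
- by apply/cvg_ex; eexists; apply: cvg_at_right_filter; apply: cdV; exact: kn0.
- by apply/cvg_ex; eexists; apply: cvg_at_left_filter; apply: cdV; exact: kn0.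
- split.
  + move=> y; rewrite in_itv/= => /andP[cy yb]; have [] // := d y.
    by rewrite kn0// ?(le_trans ac)// ltW.
  + by apply: cvg_at_right_filter; apply: cV; exact: kn0.
  + by apply: cvg_at_left_filter; apply: cV; exact: kn0.
- exact/lip_continuous/(lipS (sub _ ac cb))/lg.
Qed.

(** As for inversion, the case of intervals is a classical substitution and the general case follows
    by uniqueness of measures. *)
Lemma ge0_integration_by_reflection (g : R -> R) a b A :
  a <= b -> lip `[- b, - a] g ->
  (forall x, - b <= x -> x <= - a -> 0 <= g x) -> measurable A ->
  \int[mu]_(x in `[- b, - a] `&` -%R @^-1` A) g x =
  \int[mu]_(y in `[a, b] `&` A) g (- y).
Proof.
move=> ab lg g0 mA; congr fine.
have lw : lip `[a, b] (fun y => g (- y)).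
  apply: lip_comp (lipN (lip_id _)) lg => y.
  by rewrite /= !in_itv/= !lerN2 => /andP[-> ->].
apply: ge0_integral_preimage_itv => //.
- by apply/measurable_EFinP; exact: lip_measurable lg _ _.
- by move=> x /=; rewrite in_itv/= => /andP[? ?]; rewrite lee_fin g0.
- by apply/measurable_EFinP; exact: lip_measurable lw _ _.
- by move=> x /=; rewrite in_itv/= => /andP[? ?]; rewrite lee_fin g0 ?lerN2.
- by apply: integrable_lty => //; exact: lip_integrable lw _ _.
- by move=> x /=; rewrite in_itv/= lerNl lerNr andbC.
move=> c ac cb; rewrite -integration_by_substitution_oppr//; last first.
  apply: lip_continuous; apply: lipS lg.
  by apply: subset_itvl; rewrite bnd_simp lerN2.
congr integral; apply/seteqP; split => x /=; rewrite !in_itv/=.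
  by move=> [/andP[-> _]] /andP[+ _]; rewrite lerNr.
move=> /andP[bx xc]; rewrite bx [c <= _]lerNr xc lerNl bx.
by rewrite (le_trans xc)// lerN2.
Qed.

End change_of_variables.

(** * The map [T_o]: symmetry, measurability, inverse branches *)

Section nearest_integer_map.
Context {R : realType}.
Notation mu := (@lebesgue_measure R).
Implicit Types (x y a b : R) (A E : set R).

(** With the convention [0^-1 = 0] one formula covers [x = 0] too, because the floor of 1/2 is 0. *)
Lemma T_oE x : T_o x = x^-1 - (Num.floor (x^-1 + 1 / 2))%:~R.
Proof.
rewrite /T_o div1r; case: eqP => // ->; rewrite invr0 add0r.
rewrite (_ : Num.floor _ = 0) ?oppr0//.
by apply: floor_def; apply/andP; split; lra.
Qed.

Lemma T_o_itv x : - (1 / 2) <= T_o x < 1 / 2.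
Proof.
rewrite T_oE; have /andP[] := floor_itv (x^-1 + 1 / 2); rewrite intrD => h1 h2.
by apply/andP; split; lra.
Qed.

Lemma T_o_inv (k : int) x :
  - (1 / 2) <= x^-1 - k%:~R -> x^-1 - k%:~R < 1 / 2 -> T_o x = x^-1 - k%:~R.
Proof.
move=> h1 h2; rewrite T_oE; congr (_ - _%:~R); apply: floor_def.
by rewrite intrD; apply/andP; split; lra.
Qed.

(** [T_o] is odd except where its value is -1/2. There [- x] has the digit [- k + 1] and again the
    value -1/2, so the absolute values still agree. *)
Lemma normr_T_oN x : `|T_o (- x)| = `|T_o x|.
Proof.
pose k := Num.floor (x^-1 + 1 / 2).
have Tx : T_o x = x^-1 - k%:~R by rewrite T_oE.
have := T_o_itv x; rewrite Tx => /andP[]; rewrite le_eqVlt => /predU1P[e _|h1 h2].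
  rewrite (@T_o_inv (- k + 1)) ?invrN ?intrD ?intrN; [|lra|lra].
  by have -> : - x^-1 - (- k%:~R + 1) = x^-1 - k%:~R by lra.
rewrite (@T_o_inv (- k)) ?invrN ?intrN; [|lra|lra].
by rewrite -opprB normrN opprK addrC.
Qed.

Lemma measurable_T_o : measurable_fun [set: R] (@T_o R).
Proof.
rewrite (_ : T_o = fun x : R => x^-1 - (Num.floor (x^-1 + 1 / 2))%:~R); last first.
  by apply/funext => x; rewrite T_oE.
have mf : measurable_fun [set: R] (fun y : R => (Num.floor y)%:~R : R).
  by apply: nondecreasing_measurable => // y z yz; rewrite ler_int; exact: le_floor.
apply: measurable_funB; first exact: measurable_inv.
apply: (measurableT_comp mf); apply: measurable_funD => //; exact: measurable_inv.
Qed.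

Lemma measurable_iter_T_o n : measurable_fun [set: R] (iter n (@T_o R)).
Proof.
elim: n => [|n IH]; first exact: measurable_id.
exact: (measurableT_comp measurable_T_o IH).
Qed.

Definition symmetric_set A := forall x, A x -> A (- x).

Lemma symmetric_norm A x y : symmetric_set A -> `|x| = `|y| -> A x -> A y.
Proof.
by move=> sA /eqP; rewrite eqr_norm2 => /orP[/eqP->//|/eqP-> /sA]; rewrite opprK.
Qed.

Lemma symmetric_preimage_T_o A : symmetric_set A -> symmetric_set (T_o @^-1` A).
Proof.
by move=> sA x /=; apply: (symmetric_norm sA); rewrite normr_T_oN.
Qed.

Lemma symmetric_iter_T_o n A : symmetric_set A -> symmetric_set (iter n T_o @^-1` A).
Proof.
elim: n A => [//|n IH] A sA; rewrite [X in symmetric_set X](_ : _ =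
  iter n T_o @^-1` (T_o @^-1` A)) //.
by apply: IH; exact: symmetric_preimage_T_o.
Qed.

Lemma measurable_preimage_T_o n A : measurable A -> measurable (iter n T_o @^-1` A).
Proof. by move=> mA; rewrite -[X in measurable X]setTI; exact: measurable_iter_T_o. Qed.

(** On this interval [T_o] is [x^-1 - k] except possibly at [1 / (k + 1/2)], where the floor has
    already moved to the next digit. Removing that null point reduces the claim to the substitution
    by inversion. *)
Lemma ge0_integral_branch (f : R -> R) (k : int) a b A :
  - (1 / 2) <= a -> a <= b -> b <= 1 / 2 -> 1 <= k%:~R + a \/ k%:~R + b <= -1 ->
  lip `[(k%:~R + b)^-1, (k%:~R + a)^-1] f ->
  (forall x, (k%:~R + b)^-1 <= x -> x <= (k%:~R + a)^-1 -> 0 <= f x) ->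
  measurable A ->
  \int[mu]_(x in `[(k%:~R + b)^-1, (k%:~R + a)^-1] `&` T_o @^-1` A) f x =
  \int[mu]_(y in `[a, b] `&` A) (f (k%:~R + y)^-1 / (k%:~R + y) ^+ 2).
Proof.
move=> a2 ab b2 k1 lf f0 mA; congr fine.
rewrite -ge0_integration_by_inversion//.
set K := `[_, _]%classic.
have mK (S : set R) : measurable S -> measurable (K `&` S).
  by move=> mS; apply: measurableI => //; exact: measurable_itv.
have mf (S : set R) : measurable S -> measurable_fun (K `&` S) (EFin \o f).
  move=> mS; apply/measurable_EFinP.
  by apply: lip_measurable lf _ _; [exact: mK|move=> x []].
pose p : R := (k%:~R + 1 / 2)^-1.
have m1 : measurable (T_o @^-1` A) by exact: (@measurable_preimage_T_o 1).
have m2 : measurable ((fun x : R => x^-1 - k%:~R) @^-1` A).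
  rewrite -[X in measurable X]setTI; apply: measurable_funB => //.
  exact: measurable_inv.
rewrite -[LHS](@integral_setD1 _ _ p); last 2 first.
  by apply: measurableD => //; exact: mK.
  by apply: (measurable_funS _ _ (mf _ m1)) => [|x []//]; exact: mK.
rewrite -[RHS](@integral_setD1 _ _ p); last 2 first.
  by apply: measurableD => //; exact: mK.
  by apply: (measurable_funS _ _ (mf _ m2)) => [|x []//]; exact: mK.
have TK x : K x -> x <> p -> T_o x = x^-1 - k%:~R.
  rewrite /K /p /= in_itv/= => Kx xp.
  have /andP[ax xb] : a <= x^-1 - k%:~R <= b.
    by apply: shift_inv_itv Kx => //; case: k1 => ?; [left|right]; lra.
  apply: T_o_inv; first lra.
  rewrite lt_neqAle (le_trans xb b2) andbT; apply/eqP => e.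
  by apply: xp; rewrite -e addrC subrK invrK.
by congr integral; apply/seteqP; split=> x /= [[Kx Ax] xp];
  move: Ax; rewrite /= TK// => Ax; do 2?split => //=; rewrite TK.
Qed.

End nearest_integer_map.

(** The bounds are quotients of consecutive Fibonacci numbers; the lower one yields the constants
    13/55 and 13/112 that bound [1/(2G + 1)] and [1/(G + 7)] in the contraction estimate. *)
Lemma golden_bounds {R : realType} : 21 / 13 < (golden : R) < 13 / 8.
Proof.
have := @golden_sqr R; have := @golden_gt1 R; set g := golden.
by rewrite expr2 => g1 gg; apply/andP; split; nra.
Qed.

(** * Branch weights and their variation *)

Section digit_weights.
Context {R : realFieldType} (G : R).
Context (GG : G ^+ 2 = G + 1) (G1 : 21 / 13 < G) (G2 : G < 13 / 8).
Implicit Types (x y K : R) (k N : nat).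

Local Notation a := (2 * G + 1).

(* With [K = k + G - 2], [weight K x] is the probability of the branch
   [x |-> 1 / (k + x)] of the transfer operator of [|T_o|] normalized by the
   invariant density, and [weight_tail K x] is the sum of the weights of the
   branches [j >= k]. *)
Definition weight K x : R := (G + x) * (G + 1 - x) / (a * ((K + x) * (K + 1 + x))).
Definition weight_tail K x : R := (G + x) * (G + 1 - x) / (a * (K + x)).

Let G0 : 0 < G. Proof. by have := G1; lra. Qed.
Let a0 : 0 < a. Proof. by rewrite addr_gt0// mulr_gt0. Qed.
Let num0 x : 0 <= x <= 1 -> 0 <= (G + x) * (G + 1 - x).
Proof.
move=> /andP[x0 x1]; rewrite mulr_ge0//; first by rewrite addr_ge0// ltW.
by rewrite -addrA addr_ge0 ?(ltW G0)// subr_ge0.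
Qed.
Let numE x : (G + x) * (G + 1 - x) = a + x - x ^+ 2.
Proof.
have -> : (G + x) * (G + 1 - x) = G ^+ 2 + G + x - x ^+ 2 by ring.
by rewrite GG; ring.
Qed.
Let Kx0 K x : 0 < K -> 0 <= x -> 0 < K + x.
Proof. by move=> K0 x0; rewrite ltr_wpDr. Qed.
Let K1x0 K x : 0 < K -> 0 <= x -> 0 < K + 1 + x.
Proof. by move=> K0 x0; rewrite Kx0// addr_gt0. Qed.
Let wden0 K x : 0 < K -> 0 <= x -> 0 < a * ((K + x) * (K + 1 + x)).
Proof. by move=> K0 x0; rewrite !mulr_gt0// ?Kx0 ?K1x0. Qed.
Let tden0 K x : 0 < K -> 0 <= x -> 0 < a * (K + x).
Proof. by move=> K0 x0; rewrite mulr_gt0// Kx0. Qed.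

Lemma weight_ge0 K x : 0 < K -> 0 <= x <= 1 -> 0 <= weight K x.
Proof.
by move=> K0 x01; have /andP[x0 _] := x01; rewrite divr_ge0 ?num0// ltW// wden0.
Qed.

Lemma weight_tail_ge0 K x : 0 < K -> 0 <= x <= 1 -> 0 <= weight_tail K x.
Proof.
by move=> K0 x01; have /andP[x0 _] := x01; rewrite divr_ge0 ?num0// ltW// tden0.
Qed.

(** Partial fractions: [1/((K + x)(K + 1 + x))] is the difference of [1/(K + x)] and
    [1/(K + 1 + x)]. *)
Lemma weight_telescope K x : 0 < K -> 0 <= x ->
  weight K x = weight_tail K x - weight_tail (K + 1) x.
Proof.
move=> K0 x0; rewrite /weight /weight_tail; field.
by rewrite (gt_eqF a0) (gt_eqF (Kx0 K0 x0)) (gt_eqF (K1x0 K0 x0)).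
Qed.

(** By [G^2 = G + 1] the numerator of a weight is [a + x - x^2], so [y - x] factors out of the
    difference. In the remaining factor only the constant term [a (2K + 1) - K (K + 1)] can be
    negative, so it governs monotonicity. *)
Lemma weightB K x y : 0 < K -> 0 <= x -> 0 <= y ->
  weight K x - weight K y = (y - x) *
    (a * (2 * K + 1) - K * (K + 1) + (a + K * (K + 1)) * (x + y)
     + (2 * K + 2) * (x * y)) /
    (a * ((K + x) * (K + 1 + x)) * ((K + y) * (K + 1 + y))).
Proof.
move=> K0 x0 y0; rewrite /weight !numE; field.
by rewrite (gt_eqF a0) (gt_eqF (Kx0 K0 x0)) (gt_eqF (K1x0 K0 x0))
  (gt_eqF (Kx0 K0 y0)) (gt_eqF (K1x0 K0 y0)).
Qed.

Let weightB_den_gt0 K x y : 0 < K -> 0 <= x -> 0 <= y ->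
  0 < a * ((K + x) * (K + 1 + x)) * ((K + y) * (K + 1 + y)).
Proof. by move=> K0 x0 y0; rewrite mulr_gt0 ?wden0// mulr_gt0 ?Kx0 ?K1x0. Qed.

(* For large [K] the weight is not monotone on the left half of [0, 1];
   [weight_incr] controls the defect. *)
Lemma weight_decr_small K x y : 0 < K -> K <= G + 6 -> 0 <= x -> x <= y ->
  weight K y <= weight K x.
Proof.
move=> K0 K6 x0 xy; have y0 := le_trans x0 xy.
rewrite -subr_ge0 weightB// divr_ge0 ?(ltW (weightB_den_gt0 _ _ _))// mulr_ge0 ?subr_ge0//.
(* At [K = G + 6], the digit 8, this equals [18 G - 26 > 0]; at the digit 9 it would be
   [20 G - 38 < 0]. This is where the threshold 9 below comes from. *)
have num1 : 0 <= a * (2 * K + 1) - K * (K + 1).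
  by have := G1; have := G2; nra.
apply: addr_ge0; [apply: addr_ge0 => //|]; apply: mulr_ge0; rewrite ?(addr_ge0 x0) ?(mulr_ge0 x0)// ltW//.
  by rewrite addr_gt0// mulr_gt0// addr_gt0.
by rewrite addr_gt0// mulr_gt0.
Qed.

(** Here [x + y >= 1], so [K (K + 1) (x + y)] absorbs the negative term [- K (K + 1)] of
    [weightB]. *)
Lemma weight_decr_right K x y : 0 < K -> 1 / 2 <= x -> x <= y ->
  weight K y <= weight K x.
Proof.
move=> K0 x2 xy; have x0 : 0 <= x by apply: le_trans x2.
have y0 := le_trans x0 xy.
rewrite -subr_ge0 weightB// divr_ge0 ?(ltW (weightB_den_gt0 _ _ _))// mulr_ge0 ?subr_ge0//.
have -> : a * (2 * K + 1) - K * (K + 1) + (a + K * (K + 1)) * (x + y) =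
  a * (2 * K + 1 + (x + y)) + K * (K + 1) * (x + y - 1) by ring.
have xy1 : 0 <= x + y - 1 by lra.
apply: addr_ge0; [apply: addr_ge0|]; apply: mulr_ge0; rewrite ?(mulr_ge0 x0)// ?(ltW a0)// ltW//.
- by rewrite ltr_wpDr ?addr_ge0// addr_gt0// mulr_gt0.
- by rewrite mulr_gt0// addr_gt0.
- by rewrite addr_gt0// mulr_gt0.
Qed.

(** Only the term [K (K + 1)] of [weightB] can make the weight grow; keeping it alone and shrinking
    the denominator gives a bound shaped to telescope over [K]. *)
Lemma weight_incr K x y : 0 < K -> 0 <= x -> x <= y ->
  weight K y - weight K x <= (y - x) / a * (K^-1 - (K + 1)^-1).
Proof.
move=> K0 x0 xy; have y0 := le_trans x0 xy.
have K1 : 0 < K + 1 by rewrite addr_gt0.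
have KK : 0 < K * (K + 1) by rewrite mulr_gt0.
rewrite -opprB weightB//.
have -> : (y - x) / a * (K^-1 - (K + 1)^-1) =
    (y - x) * (K * (K + 1)) / (a * (K * (K + 1)) * (K * (K + 1))).
  by field; rewrite (gt_eqF a0) (gt_eqF K0) (gt_eqF K1).
have dK z : 0 <= z -> K * (K + 1) <= (K + z) * (K + 1 + z).
  by move=> z0; rewrite ler_pM ?(ltW K0) ?(ltW K1)// lerDl.
rewrite -mulNr -mulrN; apply: (@le_trans _ _ ((y - x) * (K * (K + 1)) /
    (a * ((K + x) * (K + 1 + x)) * ((K + y) * (K + 1 + y))))).
  rewrite ler_wpM2r ?invr_ge0 ?(ltW (weightB_den_gt0 _ _ _))// ler_wpM2l ?subr_ge0//.
  rewrite -subr_ge0.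
  have -> : forall n m l, K * (K + 1) - - (n - K * (K + 1) + m + l) = n + m + l :> R.
    by move=> n m l; ring.
  rewrite !addr_ge0// mulr_ge0 ?(addr_ge0 x0) ?(mulr_ge0 x0)// ltW//.
  by rewrite addr_gt0// mulr_gt0.
  by rewrite addr_gt0// mulr_gt0.
  by rewrite addr_gt0// mulr_gt0.
rewrite ler_wpM2l ?mulr_ge0 ?subr_ge0 ?(ltW K0) ?(ltW K1)//.
rewrite lef_pV2 ?posrE ?weightB_den_gt0// ?mulr_gt0//.
by rewrite ler_pM ?mulr_ge0 ?(ltW K0) ?(ltW K1) ?(ltW a0) ?dK// ler_wpM2l ?(ltW a0) ?dK.
Qed.

(** The numerator grows by [(y - x) (1 - (x + y))], which is at most [y - x], while the denominator
    grows as well and is at least [a K]. *)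
Lemma weight_tail_incr K x y : 0 < K -> 0 <= x -> x <= y -> x + y <= 1 ->
  weight_tail K y - weight_tail K x <= (y - x) / a * K^-1.
Proof.
move=> K0 x0 xy xy1; have y0 := le_trans x0 xy.
have x01 : 0 <= x <= 1 by rewrite x0 (le_trans _ xy1)// lerDl.
rewrite /weight_tail.
have -> : (G + y) * (G + 1 - y) = (G + x) * (G + 1 - x) + (y - x) * (1 - (x + y)).
  by ring.
have -> : (y - x) / a * K^-1 = (y - x) / (a * K).
  by field; rewrite (gt_eqF a0) (gt_eqF K0).
rewrite mulrDl lerBlDl lerD//.
  rewrite ler_wpM2l ?num0//.
  by rewrite lef_pV2 ?posrE ?tden0// ler_wpM2l ?(ltW a0)// lerD2l.
apply: ler_pM; rewrite ?invr_ge0 ?(ltW (tden0 _ _))// ?mulr_ge0 ?subr_ge0//.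
  by rewrite ler_piMr ?subr_ge0// gerBl addr_ge0.
by rewrite lef_pV2 ?posrE ?tden0 ?mulr_gt0// ler_wpM2l ?(ltW a0)// lerDl.
Qed.

Lemma weight_tail_decr_right K x y : 0 < K -> 1 / 2 <= x -> x <= y -> y <= 1 ->
  weight_tail K y <= weight_tail K x.
Proof.
move=> K0 x2 xy y1; have x0 : 0 <= x by apply: le_trans x2.
have y0 := le_trans x0 xy.
apply: ler_pM; rewrite ?num0 ?y0// ?invr_ge0 ?(ltW (tden0 _ _))//.
  rewrite -subr_ge0.
  have -> : (G + x) * (G + 1 - x) - (G + y) * (G + 1 - y) = (y - x) * (x + y - 1).
    by ring.
  by rewrite mulr_ge0 ?subr_ge0//; lra.
by rewrite lef_pV2 ?posrE ?tden0// ler_wpM2l ?(ltW a0)// lerD2l.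
Qed.

Local Notation K k := (k%:R + (G - 2)).

Lemma digit_gt0 k : (2 <= k)%N -> 0 < K k.
Proof.
by rewrite -(ler_nat R) => k2; rewrite addrCA ltr_pwDl ?G0// subr_ge0.
Qed.

Lemma digitS k : K k.+1 = K k + 1.
Proof. by rewrite -natr1 addrAC. Qed.

Lemma sum_weight k N x : (2 <= k)%N -> (k <= N)%N -> 0 <= x ->
  \sum_(k <= j < N) weight (K j) x = weight_tail (K k) x - weight_tail (K N) x.
Proof.
move=> k2 kN x0; have /= tele := telescope_sumr (fun j => weight_tail (K j) x) kN.
rewrite -[RHS]opprB -tele -sumrN; apply: eq_big_nat => j /andP[kj _].
by rewrite opprB digitS weight_telescope// digit_gt0// (leq_trans k2).
Qed.

Lemma weight_tail2 x : 0 <= x -> weight_tail (K 2) x = (G + 1 - x) / a.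
Proof.
move=> x0; rewrite /weight_tail addrCA subrr addr0; field.
by rewrite (gt_eqF a0) (gt_eqF (Kx0 G0 x0)).
Qed.

(** Total probability is 1: the first term collects the branches [1 / (k + x)], the second the
    branches [1 / (k + 1 - x)], for all [k >= 2]. *)
Lemma weight_tail2D x : 0 <= x <= 1 ->
  weight_tail (K 2) x + weight_tail (K 2) (1 - x) = 1.
Proof.
move=> /andP[x0 x1]; rewrite !weight_tail2 ?subr_ge0//.
by field; rewrite (gt_eqF a0).
Qed.

Lemma weight2_le x : 0 <= x <= 1 -> weight (K 2) x <= a^-1.
Proof.
move=> /andP[x0 x1]; have Gx := Kx0 G0 x0; have G1x := K1x0 G0 x0.
have -> : weight (K 2) x = a^-1 * ((G + 1 - x) / (G + 1 + x)).
  rewrite /weight addrCA subrr addr0; field.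
  by rewrite (gt_eqF a0) (gt_eqF Gx) (gt_eqF G1x).
rewrite ler_piMr ?invr_ge0 ?(ltW a0)// ler_pdivrMr// mul1r lerD2l.
by rewrite (le_trans _ x0)// oppr_le0.
Qed.

Lemma sum_weightB N x y : (2 <= N)%N -> 0 <= x -> 0 <= y ->
  \sum_(2 <= k < N) (weight (K k) x - weight (K k) y) =
  (y - x) / a - (weight_tail (K N) x - weight_tail (K N) y).
Proof.
move=> N2 x0 y0; rewrite sumrB !sum_weight// !weight_tail2//.
by field; rewrite (gt_eqF a0).
Qed.

(** Digits below 9 have differences of one sign. From 9 on, each absolute value exceeds the signed
    difference by at most twice the defect of [weight_incr], and these defects telescope from
    [1 / (G + 7)]. The signed differences sum to [(y - x) / a] up to a tail, which the last
    telescoped term absorbs. *)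
Lemma sum_weight_normB_left N x y : (9 <= N)%N -> 0 <= x -> x <= y -> x + y <= 1 ->
  \sum_(2 <= k < N) `|weight (K k) x - weight (K k) y| <=
    (y - x) / a * (1 + 2 / (G + 7)).
Proof.
move=> N9 x0 xy xy1; have y0 := le_trans x0 xy.
have N2 : (2 <= N)%N by exact: leq_trans N9.
have c0 : 0 <= (y - x) / a by rewrite divr_ge0 ?subr_ge0// (ltW a0).
have tail := weight_tail_incr (digit_gt0 N2) x0 xy xy1.
have tele := sum_weightB N2 x0 y0.
have KN0 := digit_gt0 N2.
have e9 : (K 9)^-1 = (G + 7)^-1 by congr (_^-1); ring.
rewrite -e9; pose e k := (K k)^-1; rewrite -/(e 9%N) -/(e N) in tail *.
have eN : 0 <= (y - x) / a * e N by rewrite mulr_ge0// invr_ge0 ltW.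
set c := (y - x) / a in c0 tail tele eN *.
have small : \sum_(2 <= k < 9) `|weight (K k) x - weight (K k) y| =
    \sum_(2 <= k < 9) (weight (K k) x - weight (K k) y).
  apply: eq_big_nat => k /andP[k2 k9].
  rewrite ger0_norm// subr_ge0 weight_decr_small ?digit_gt0//.
  rewrite addrCA lerD2l lerBlDr -natrD ler_nat; exact: k9.
have large : \sum_(9 <= k < N) `|weight (K k) x - weight (K k) y| <=
    \sum_(9 <= k < N) (weight (K k) x - weight (K k) y) + 2 * c * (e 9 - e N).
  have -> : e 9 - e N = \sum_(9 <= k < N) (e k - e k.+1).
    by rewrite -[LHS]opprB -(telescope_sumr e N9) -sumrN; apply: eq_bigr => k _; rewrite opprB.
  rewrite mulr_sumr -big_split/=; apply: ler_sum_nat => k /andP[k9 _].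
  have K0 : 0 < K k by rewrite digit_gt0// (leq_trans _ k9).
  have := weight_incr K0 x0 xy; rewrite -/c -digitS -/(e k) -/(e k.+1).
  have : 0 <= c * (e k - e k.+1).
    rewrite mulr_ge0// subr_ge0 /e digitS lef_pV2 ?posrE ?(addr_gt0 K0)//.
    by rewrite lerDl.
  move: (weight _ _) (weight _ _) (e k) (e k.+1) => u v e1 e2.
  by case: ler0P => ? ? ?; lra.
rewrite (big_cat_nat _ N9)//= small; move: tele; rewrite (big_cat_nat _ N9)//=.
move: large tail eN.
set s1 := \sum_(_ <= _ < _) _; set s2 := \sum_(_ <= _ < _) _.
set s3 := \sum_(_ <= _ < _) _.
move: s1 s2 s3 (e 9%N) (e N) (weight_tail _ _) (weight_tail _ _).
move=> s1 s2 s3 e1 e2 t1 t2; lra.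
Qed.

Lemma sum_weight_normB_right N x y : (2 <= N)%N -> 1 / 2 <= x -> x <= y -> y <= 1 ->
  \sum_(2 <= k < N) `|weight (K k) x - weight (K k) y| <= (y - x) / a.
Proof.
move=> N2 x2 xy y1; have x0 : 0 <= x by apply: le_trans x2.
have y0 := le_trans x0 xy.
rewrite (eq_big_nat _ _ (F2 := fun k => weight (K k) x - weight (K k) y)); last first.
  move=> k /andP[k2 _].
  by rewrite ger0_norm// subr_ge0 weight_decr_right ?digit_gt0.
by rewrite sum_weightB// gerBl subr_ge0 weight_tail_decr_right ?digit_gt0.
Qed.

End digit_weights.

(** * The truncated transfer operator and its contraction of Lipschitz constants *)

Section truncated_transfer.
Context {R : realType}.
Implicit Types (x y L : R) (f : R -> R) (k N : nat).
Local Notation G := (@golden R).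
Local Notation J := (`[0, 1 / 2]%classic : set R).

Definition digit_weight k x : R := weight G (k%:R + (G - 2)) x.
Definition digit_tail k x : R := weight_tail G (k%:R + (G - 2)) x.
Local Notation p := digit_weight.
Local Notation S := digit_tail.

Let G1 : 21 / 13 < G. Proof. by have /andP[] := @golden_bounds R. Qed.
Let G2 : G < 13 / 8. Proof. by have /andP[] := @golden_bounds R. Qed.

Lemma digit_weight_ge0 k x : (2 <= k)%N -> 0 <= x <= 1 -> 0 <= p k x.
Proof. by move=> k2; apply: weight_ge0; [exact: G1|exact: digit_gt0]. Qed.

Lemma digit_tail_ge0 k x : (2 <= k)%N -> 0 <= x <= 1 -> 0 <= S k x.
Proof. by move=> k2; apply: weight_tail_ge0; [exact: G1|exact: digit_gt0]. Qed.

Lemma sum_digit_weight k N x : (2 <= k)%N -> (k <= N)%N -> 0 <= x ->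
  \sum_(k <= j < N) p j x = S k x - S N x.
Proof. exact: sum_weight. Qed.

Lemma inverse_branch_itv k x : (2 <= k)%N -> 0 <= x -> J (k%:R + x)^-1.
Proof.
rewrite -(ler_nat R) => k2 x0; have kx : 2 <= k%:R + x by rewrite -[2]addr0 lerD.
have kx0 : 0 < k%:R + x by exact: lt_le_trans kx.
by rewrite /= in_itv/= invr_ge0 (ltW kx0) div1r lef_pV2 ?posrE.
Qed.

Definition branch_sum N f x := \sum_(2 <= k < N) p k x * f (k%:R + x)^-1.

(** Each term varies through the branch, which contracts by [1 / ((k + x)(k + y))], and through the
    weight, multiplied by a value of size at most [L / 4]. The digit 2 is kept apart because the
    contraction is at most 1/9 only from the digit 3 on. *)
Lemma branch_sumB N L f x y : (3 <= N)%N -> 0 <= L -> klip L J f ->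
  (forall z, J z -> `|f z| <= L / 4) -> 0 <= x <= 1 -> 0 <= y <= 1 ->
  `|branch_sum N f x - branch_sum N f y| <=
    L * (`|x - y| * (p 2 x / ((2 + x) * (2 + y)) + S 3 x / 9)
         + 4^-1 * \sum_(2 <= k < N) `|p k x - p k y|).
Proof.
move=> N3 L0 Lf f4 x01 y01; have /andP[x0 x1] := x01; have /andP[y0 y1] := y01.
have kx0 k (z : R) : (2 <= k)%N -> 0 <= z -> 0 < k%:R + z.
  by move=> k2 z0; rewrite ltr_wpDr// ltr0n (leq_trans _ k2).
rewrite /branch_sum -sumrB; apply: le_trans (ler_norm_sum _ _ _) _.
have term k : (2 <= k)%N ->
    `|p k x * f (k%:R + x)^-1 - p k y * f (k%:R + y)^-1| <=
    L * (`|x - y| * (p k x / ((k%:R + x) * (k%:R + y)))) + L * (4^-1 * `|p k x - p k y|).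
  move=> k2; have kx := kx0 _ _ k2 x0; have ky := kx0 _ _ k2 y0.
  have -> : p k x * f (k%:R + x)^-1 - p k y * f (k%:R + y)^-1 =
      p k x * (f (k%:R + x)^-1 - f (k%:R + y)^-1) +
      (p k x - p k y) * f (k%:R + y)^-1 by ring.
  apply: le_trans (ler_normD _ _) _; apply: lerD; rewrite normrM.
    rewrite (ger0_norm (digit_weight_ge0 k2 x01)).
    have := Lf _ _ (inverse_branch_itv k2 x0) (inverse_branch_itv k2 y0).
    have -> : (k%:R + x)^-1 - (k%:R + y)^-1 = (y - x) / ((k%:R + x) * (k%:R + y)).
      by field; rewrite (gt_eqF kx) (gt_eqF ky).
    rewrite normrM [`|y - x|]distrC [`|((k%:R + x) * (k%:R + y))^-1|]ger0_norm; last first.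
      by rewrite invr_ge0 ltW// mulr_gt0.
    move=> h; apply: le_trans (ler_wpM2l (digit_weight_ge0 k2 x01) h) _.
    by rewrite le_eqVlt; apply/orP; left; apply/eqP; ring.
  rewrite mulrA [leRHS]mulrC ler_wpM2l//.
  by rewrite f4//; exact: inverse_branch_itv.
apply: (@le_trans _ _ (\sum_(2 <= k < N)
    (L * (`|x - y| * (p k x / ((k%:R + x) * (k%:R + y)))) +
     L * (4^-1 * `|p k x - p k y|)))).
  by apply: ler_sum_nat => k /andP[k2 _]; exact: term.
rewrite big_split/= -!mulr_sumr -mulrDr ler_wpM2l// lerD2r ler_wpM2l//.
rewrite big_ltn// lerD2l.
apply: (@le_trans _ _ (\sum_(3 <= k < N) (p k x / 9))).
  apply: ler_sum_nat => k /andP[k3 _]; have k2 := ltnW k3.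
  have k3x z : 0 <= z -> 3 <= k%:R + z.
    by move=> z0; rewrite -[3]addr0 lerD// ler_nat.
  rewrite ler_wpM2l ?digit_weight_ge0// lef_pV2 ?posrE ?mulr_gt0 ?kx0//.
  have -> : 9 = 3 * 3 :> R by ring.
  by rewrite ler_pM// k3x.
by rewrite -mulr_suml ler_wpM2r ?invr_ge0// sum_digit_weight// gerBl digit_tail_ge0// ltnW.
Qed.

(* The branch [y |-> 1 / (k + 1 - y)] of the folded map is
   [x |-> 1 / (k + x)] at [x = 1 - y], and its weight is [digit_weight k (1 - y)].
   Sending the mass of the discarded branches to the point 1/4, the midpoint of
   [0, 1/2], makes constants fixed points of the truncated operator. *)
Definition truncated_transfer N f x : R :=
  f (1 / 4) + (branch_sum N (fun z => f z - f (1 / 4)) x +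
               branch_sum N (fun z => f z - f (1 / 4)) (1 - x)).

Definition contraction_rate : R := 288 / 1000.

Let J4 : J (1 / 4).
Proof. by rewrite /= in_itv/=; apply/andP; split; lra. Qed.

(* The total contraction factor is
   1/9 + (1/4 + 4/25 - 2/9)/a + (1 + 1/(G + 7))/(2a) with a = 2G + 1. *)
Lemma contraction_factor (p1 p2 t1 t2 u1 u2 l r c a1 b1 : R) :
  0 <= c -> 0 <= a1 -> a1 <= 13 / 55 -> 0 <= b1 -> b1 <= 13 / 112 ->
  p1 <= a1 -> p2 <= a1 -> t1 + t2 = 1 - p1 - p2 ->
  u1 <= p1 / 4 -> u2 <= p2 * (4 / 25) ->
  l <= c * a1 * (1 + 2 * b1) -> r <= c * a1 ->
  c * (u1 + t1 / 9) + 4^-1 * l + (c * (u2 + t2 / 9) + 4^-1 * r) <=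
  c * contraction_rate.
Proof.
move=> c0 a10 a1le b10 b1le p1le p2le tE u1le u2le lle rle.
have hu : u1 + t1 / 9 + (u2 + t2 / 9) <= 1 / 9 + (1 / 4 + 4 / 25 - 2 / 9) * a1.
  by clear -p1le p2le tE u1le u2le; lra.
have hb : a1 * (1 + b1) <= 13 / 55 * (1 + 13 / 112).
  by apply: ler_pM => //; [rewrite addr_ge0|rewrite lerD2l].
have hl : l + r <= c * (a1 * (1 + b1)) * 2 by clear -lle rle; lra.
have hc : c * (u1 + t1 / 9 + (u2 + t2 / 9)) + c * (a1 * (1 + b1)) / 2 <=
    c * contraction_rate.
  rewrite -mulrA -mulrDr ler_wpM2l//.
  by rewrite /contraction_rate; clear -hu hb a1le; lra.
by clear -hc hl; lra.
Qed.

Lemma contraction_rate_gt0 : 0 < contraction_rate.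
Proof. by rewrite /contraction_rate; lra. Qed.

(** The points [x], [y] lie in the left half of [0, 1] and [1 - x], [1 - y] in the right half, so
    one branch sum uses the left variation bound and the other the sharper right one. *)
Lemma klip_truncated_transfer N L f : (9 <= N)%N -> 0 <= L -> klip L J f ->
  klip (contraction_rate * L) J (truncated_transfer N f).
Proof.
move=> N9 L0 Lf x y; wlog xy : x y / x <= y.
  move=> h Jx Jy; have [xy|yx] := leP x y; first exact: h.
  by rewrite distrC [`|x - y|]distrC h// ltW.
rewrite /= !in_itv/= => /andP[x0 x2] /andP[y0 y2].
(* No point of [0, 1/2] is farther than 1/4 from the midpoint, so [g] is at most [L / 4] in
   modulus. *)
pose g z := f z - f (1 / 4).
have Lg : klip L J g by move=> z t Jz Jt; rewrite /g opprB addrA subrK; exact: Lf.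
have g4 z : J z -> `|g z| <= L / 4.
  move=> Jz; apply: le_trans (Lf _ _ Jz J4) _; rewrite ler_wpM2l//.
  by move: Jz; rewrite /= in_itv/= ler_norml => /andP[? ?]; apply/andP; split; lra.
have N2 : (2 <= N)%N by exact: leq_trans N9.
have N3 : (3 <= N)%N by exact: leq_trans N9.
have xy1 : x + y <= 1 by lra.
have x1 : x <= 1 by lra.
have y1 : y <= 1 by lra.
have y2' : 1 / 2 <= 1 - y by lra.
have x01 : 0 <= x <= 1 by rewrite x0.
have y01 : 0 <= y <= 1 by rewrite y0.
have x01' : 0 <= 1 - x <= 1 by rewrite subr_ge0 x1 gerBl.
have y01' : 0 <= 1 - y <= 1 by rewrite subr_ge0 y1 gerBl.
have e : 1 - x - (1 - y) = y - x by ring.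
have hl : \sum_(2 <= k < N) `|p k x - p k y| <= (y - x) / (2 * G + 1) * (1 + 2 / (G + 7)).
  exact: (sum_weight_normB_left golden_sqr G1 G2 N9 x0 xy xy1).
have hr : \sum_(2 <= k < N) `|p k (1 - x) - p k (1 - y)| <= (y - x) / (2 * G + 1).
  rewrite -e; under eq_bigr do rewrite distrC.
  apply: (sum_weight_normB_right golden_sqr G1 N2 y2'); last by rewrite gerBl.
  by rewrite lerD2l lerN2.
have h1 := branch_sumB N3 L0 Lg g4 x01 y01.
have h2 := branch_sumB N3 L0 Lg g4 x01' y01'.
rewrite [`|x - y|]distrC [`|y - x|]ger0_norm ?subr_ge0// in h1 *.
rewrite e [`|y - x|]ger0_norm ?subr_ge0// in h2.
have -> : truncated_transfer N f x - truncated_transfer N f y =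
  (branch_sum N g x - branch_sum N g y) +
  (branch_sum N g (1 - x) - branch_sum N g (1 - y)).
  by rewrite /truncated_transfer -/g; ring.
apply: le_trans (ler_normD _ _) _; apply: le_trans (lerD h1 h2) _.
have -> : contraction_rate * L * (y - x) = L * ((y - x) * contraction_rate) by ring.
rewrite -(mulrDr L) ler_wpM2l//.
have g1 := G1.
have a0 : 0 <= (2 * G + 1)^-1 by rewrite invr_ge0; lra.
have b0 : 0 <= (G + 7)^-1 by rewrite invr_ge0; lra.
apply: (contraction_factor (p1 := p 2 x) (p2 := p 2 (1 - x)) _ _ _ _ _ _ _ _ _ _ hl hr);
  rewrite ?subr_ge0//.
- by rewrite -[13 / 55]invrK lef_pV2 ?posrE ?invr_gt0; lra.
- by rewrite -[13 / 112]invrK lef_pV2 ?posrE ?invr_gt0; lra.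
- exact: (weight2_le g1).
- exact: (weight2_le g1).
(* Digits from 3 on carry the total mass 1 minus the two weights of the digit 2. *)
- have := weight_tail2D g1 x01; rewrite /p /S.
  rewrite !(@weight_telescope _ _ g1 (2%:R + _)) ?(digit_gt0 g1)// ?subr_ge0//.
  by rewrite -!digitS; move: (weight_tail _ _ _) => *; lra.
- rewrite ler_wpM2l ?digit_weight_ge0//.
  have x2p : 2 <= 2 + x by rewrite lerDl.
  have y2p : 2 <= 2 + y by rewrite lerDl.
  rewrite lef_pV2 ?posrE ?mulr_gt0 ?(lt_le_trans _ x2p) ?(lt_le_trans _ y2p)//.
  have -> : 4 = 2 * 2 :> R by ring.
  by rewrite ler_pM.
- rewrite ler_wpM2l ?digit_weight_ge0//.
  (* As [1 - x] and [1 - y] are at least 1/2, the branch of digit 2 contracts by [(2/5)^2 = 4/25]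
     here, against 1/4 on the other side. *)
  have x2p : 5 / 2 <= 2 + (1 - x) by lra.
  have y2p : 5 / 2 <= 2 + (1 - y) by lra.
  have h0 : 0 < 5 / 2 :> R by [].
  have -> : 4 / 25 = (5 / 2 * (5 / 2))^-1 :> R by field.
  have X := lt_le_trans h0 x2p; have Y := lt_le_trans h0 y2p.
  by rewrite lef_pV2 ?posrE ?(mulr_gt0 X Y) ?(mulr_gt0 h0 h0)// ler_pM// ltW.
Qed.

(** Since all weights sum to 1, subtracting [f (1 / 4)] inside the sums and adding it back leaves it
    multiplied by the mass of the discarded branches. *)
Lemma truncated_transferB N f x : (2 <= N)%N -> 0 <= x <= 1 ->
  truncated_transfer N f x - (branch_sum N f x + branch_sum N f (1 - x)) =
  f (1 / 4) * (S N x + S N (1 - x)).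
Proof.
move=> N2 x01; have /andP[x0 x1] := x01.
have bE z : 0 <= z -> branch_sum N (fun z => f z - f (1 / 4)) z =
    branch_sum N f z - (S 2 z - S N z) * f (1 / 4).
  move=> z0; rewrite -sum_digit_weight// mulr_suml -sumrB.
  by apply: eq_bigr => k _; ring.
rewrite /truncated_transfer !bE ?subr_ge0//.
have -> : S 2 x = 1 - S 2 (1 - x).
  apply/eqP; rewrite eq_sym subr_eq eq_sym; apply/eqP.
  exact: (weight_tail2D G1 x01).
ring.
Qed.

(** Positivity lets the operator be applied again in the induction on the number of steps, which
    works with nonnegative densities. *)
Lemma truncated_transfer_ge0 N f x : (2 <= N)%N -> (forall z, J z -> 0 <= f z) ->
  0 <= x <= 1 -> 0 <= truncated_transfer N f x.
Proof.
move=> N2 f0 x01; have /andP[x0 x1] := x01.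
have x01' : 0 <= 1 - x <= 1 by rewrite subr_ge0 x1 gerBl.
have b0 z : 0 <= z <= 1 -> 0 <= branch_sum N f z.
  move=> z01; have /andP[z0 _] := z01; rewrite /branch_sum big_nat.
  apply: sumr_ge0 => k /andP[k2 _].
  by rewrite mulr_ge0 ?digit_weight_ge0 ?f0//; exact: inverse_branch_itv.
rewrite -[truncated_transfer _ _ _](subrK (branch_sum N f x + branch_sum N f (1 - x))).
by rewrite truncated_transferB// addr_ge0 ?addr_ge0 ?b0// mulr_ge0 ?f0// addr_ge0 ?digit_tail_ge0.
Qed.

Lemma digit_tail_le N x : (2 <= N)%N -> 0 <= x <= 1 -> S N x <= 3 / (N%:R - 1).
Proof.
move=> N2 /andP[x0 x1]; have N1 : 0 < N%:R - 1 :> R by rewrite subr_gt0 ltr1n.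
have := G1; rewrite /S /weight_tail => g1.
have a0 : 0 < 2 * G + 1 by lra.
have K0 : N%:R - 1 <= N%:R + (G - 2) + x by lra.
have K1 := lt_le_trans N1 K0.
have -> : (G + x) * (G + 1 - x) / ((2 * G + 1) * (N%:R + (G - 2) + x)) =
    (G + x) / (2 * G + 1) * ((G + 1 - x) / (N%:R + (G - 2) + x)).
  by field; rewrite (gt_eqF a0) (gt_eqF K1).
have h1 : 0 <= G + x by lra.
have h2 : 0 <= G + 1 - x by lra.
have h3 : (G + x) / (2 * G + 1) <= 1 by rewrite ler_pdivrMr//; lra.
rewrite -[leRHS]mul1r; apply: ler_pM => //; rewrite ?(divr_ge0 h1 (ltW a0)) ?(divr_ge0 h2 (ltW K1))//.
apply: ler_pM => //; first by rewrite invr_ge0 ltW.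
  by have := G2; lra.
by rewrite lef_pV2 ?posrE.
Qed.

End truncated_transfer.

(** * One step of the folded map as a transfer operator *)

Section folded_transfer.
Context {R : realType}.
Implicit Types (x y a b c L : R) (f : R -> R) (k n N : nat) (A E B : set R).
Notation mu := (@lebesgue_measure R).
Local Notation G := (@golden R).
Local Notation J := (`[0, 1 / 2]%classic : set R).

Let norm_le1 x : `[-1, 1]%classic x -> `|x| <= 1.
Proof. by rewrite /= in_itv/= ler_norml. Qed.

Lemma density_o_ge0_unit x : `[-1, 1]%classic x -> 0 <= density_o x.
Proof.
move=> /norm_le1 xb; have g1 := @golden_gt1 R; have n0 := normr_ge0 x.
rewrite mulr_ge0 ?divr_ge0 ?mulr_ge0 ?(ltW (ln_golden_gt0))// addr_ge0// divr_ge0//; lra.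
Qed.

(** On [-1, 1] both denominators are at least [golden], hence at least 1. *)
Lemma lip_density_o : lip `[-1, 1] (@density_o R).
Proof.
have g1 := @golden_gt1 R.
have ln : lip `[-1, 1] (fun x : R => `|x|).
  by exists 1 => // x y _ _; rewrite mul1r; exact: ler_dist_dist.
have lip_div u : (forall x, `[-1, 1]%classic x -> 1 <= u x) -> lip `[-1, 1] u ->
    lip `[-1, 1] (fun x => 1 / u x).
  move=> u1 lu; apply: (@eq_lip _ _ (fun x => (u x)^-1)) => [x _|]; first by rewrite div1r.
  by apply: lip_inv => // x /u1 ux; rewrite ler_normr ux.
apply: lipM; first exact: lip_cst.
apply: lipD; apply: lip_div.
- by move=> x _; have := normr_ge0 x; lra.
- by apply: lipD => //; exact: lip_cst.
- by move=> x /norm_le1 xb; lra.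
- by apply: lipD; [exact: lip_cst|exact: lipN].
Qed.

Lemma Rintegral_itv_split f a b c B : a <= b -> b <= c -> lip `[a, c] f -> measurable B ->
  \int[mu]_(x in `[a, c] `&` B) f x =
  \int[mu]_(x in `[a, b] `&` B) f x + \int[mu]_(x in `[b, c] `&` B) f x.
Proof.
move=> ab bc lf mB.
have -> : `[a, c]%classic `&` B = (`[a, b] `&` B) `|` (`]b, c] `&` B).
  rewrite -setIUl; congr (_ `&` _); apply/seteqP; split => x /=; rewrite !in_itv/=.
    by move=> /andP[ax xc]; have [xb|bx] := leP x b; [left|right]; rewrite ?ax ?xb ?bx.
  by move=> [/andP[-> xb]|/andP[bx ->]]; rewrite ?(le_trans xb)// andbT (le_trans ab)// ltW.
have mI (i : interval R) : measurable ([set` i] `&` B).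
  by apply: measurableI => //; exact: measurable_itv.
rewrite Rintegral_setU; [|exact: mI|exact: mI| |]; last 2 first.
- apply: lip_integrable lf _ _; first by apply: measurableU; exact: mI.
  move=> x /= []; rewrite !in_itv/=.
    by move=> [/andP[-> xb] _]; rewrite (le_trans xb).
  by move=> [/andP[bx ->] _]; rewrite andbT (le_trans ab)// ltW.
- apply/disj_setPS => x /= [[+ _] [+ _]]; rewrite !in_itv/= => /andP[_ xb] /andP[bx _].
  by move: (lt_le_trans bx xb); rewrite ltxx.
congr (_ + _); congr fine.
have e : `]b, c]%classic `&` B = (`[b, c]%classic `&` B) `\ b.
  apply/seteqP; split => x /=; rewrite !in_itv/=.
    by move=> [/andP[bx ->] Bx]; rewrite (ltW bx); split => //; apply/eqP; rewrite gt_eqF.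
  by move=> [[/andP[bx ->] Bx] /eqP xb]; rewrite lt_neqAle eq_sym xb bx.
rewrite e integral_setD1//; first by rewrite -e; exact: mI.
rewrite -e; apply/measurable_EFinP; apply: lip_measurable lf _ _; first exact: mI.
by move=> x /= []; rewrite !in_itv/= => /andP[bx ->] _; rewrite andbT (le_trans ab)// ltW.
Qed.

(** Density times Jacobian on a branch is the weight times a factor independent of [k]. On [0, 1/2]
    this factor is [density_o x], and it is invariant under [x -> 1 - x], so the branches at [1 - x]
    share it. *)
Lemma density_o_branch k x : (2 <= k)%N -> 0 <= x <= 1 ->
  density_o (k%:R + x)^-1 / (k%:R + x) ^+ 2 =
  digit_weight k x *
    (1 / (2 * ln G) * ((2 * G + 1) / ((G + x) * (G + 1 - x)))).
Proof.
move=> k2 /andP[x0 x1]; have g1 := @golden_gt1 R.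
have k2R : 2 <= k%:R :> R by rewrite ler_nat.
rewrite /digit_weight /weight.
set s := k%:R + x; have s2 : 2 <= s by rewrite /s -[2]addr0 lerD.
have -> : k%:R + (G - 2) + x = s + G - 2 by rewrite /s; ring.
have -> : k%:R + (G - 2) + 1 + x = s + G - 1 by rewrite /s; ring.
have s0 : 0 < s by lra.
rewrite /density_o ger0_norm ?invr_ge0 ?(ltW s0)//.
rewrite -[LHS]mulrA [RHS]mulrCA; congr (_ * _).
have h1 : 0 < G + x by lra.
have h2 : 0 < G + 1 - x by lra.
have h3 : 0 < s + G - 2 by lra.
have h4 : 0 < s + G - 1 by lra.
have h5 : 0 < 2 * G + 1 by lra.
have GG := @golden_sqr R.
(* Both denominators factor through [G^2 = G + 1], which produces the shifts [s + G - 1] and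
   [s + G - 2] of the weights. *)
have e1 : G * s + 1 = G * (s + G - 1).
  have -> : G * (s + G - 1) = G * s + G ^+ 2 - G by ring.
  by rewrite GG; ring.
have e2 : (G + 1) * s - 1 = (G + 1) * (s + G - 2).
  have -> : (G + 1) * (s + G - 2) = (G + 1) * s + G ^+ 2 - G - 2 by ring.
  by rewrite GG; ring.
have G0 : 0 < G by lra.
have G1' : 0 < G + 1 by lra.
have X0 : 0 < G * s + 1 by rewrite addr_gt0// mulr_gt0.
have Y0 : 0 < (G + 1) * s - 1 by rewrite e2 mulr_gt0.
have -> : (1 / (G + s^-1) + 1 / (G + 1 - s^-1)) / s ^+ 2 =
    (2 * G + 1) / ((G * s + 1) * ((G + 1) * s - 1)).
  have -> : G + s^-1 = (G * s + 1) / s by field; rewrite (gt_eqF s0).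
  have -> : G + 1 - s^-1 = ((G + 1) * s - 1) / s by field; rewrite (gt_eqF s0).
  by field; rewrite (gt_eqF s0) (gt_eqF X0) (gt_eqF Y0).
have -> : (G * s + 1) * ((G + 1) * s - 1) =
    (2 * G + 1) * ((s + G - 2) * (s + G - 1)).
  rewrite e1 e2; have -> : 2 * G + 1 = G ^+ 2 + G by rewrite GG; ring.
  by ring.
by field; rewrite (gt_eqF h1) (gt_eqF h2) (gt_eqF h3) (gt_eqF h4) (gt_eqF h5).
Qed.

Lemma density_oE x : J x ->
  density_o x = 1 / (2 * ln G) * ((2 * G + 1) / ((G + x) * (G + 1 - x))).
Proof.
have g1 := @golden_gt1 R.
rewrite /= in_itv/= => /andP[x0 x2]; rewrite /density_o ger0_norm//; congr (_ * _).
have h1 : 0 < G + x by lra.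
have h2 : 0 < G + 1 - x by lra.
by field; rewrite (gt_eqF h1) (gt_eqF h2).
Qed.

Lemma right_half_sub : J `<=` `[-1, 1].
Proof. by move=> x; rewrite /= !in_itv/= => /andP[x0 x2]; apply/andP; split; lra. Qed.

Let mJ A : measurable A -> measurable (J `&` A).
Proof. by move=> mA; apply: measurableI => //; exact: measurable_itv. Qed.

Lemma Rintegral_reflection g a b A : a <= b -> lip `[- b, - a] g ->
  (forall x, - b <= x -> x <= - a -> 0 <= g x) ->
  measurable A -> symmetric_set A ->
  \int[mu]_(x in `[- b, - a] `&` A) g x = \int[mu]_(x in `[a, b] `&` A) g (- x).
Proof.
move=> ab lg g0 mA sA; rewrite -ge0_integration_by_reflection//.
by congr (Rintegral _ (_ `&` _)); apply/seteqP; split => x /sA //=; rewrite opprK.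
Qed.

Section one_step.
Variables (f : R -> R) (A : set R).
Hypotheses (lf : lip J f) (f0 : forall x, J x -> 0 <= f x).
Hypotheses (mA : measurable A) (sA : symmetric_set A).

Let F x := f x * density_o x.
(** The integrand pulled back along [x -> 1 / (k + x)], Jacobian included. *)
Let w k x := F (k%:R + x)^-1 / (k%:R + x) ^+ 2.

Let lF : lip J F.
Proof. by apply: lipM => //; exact: lipS right_half_sub lip_density_o. Qed.

Let F0 x : J x -> 0 <= F x.
Proof. by move=> Jx; rewrite mulr_ge0 ?f0// density_o_ge0_unit//; exact: right_half_sub. Qed.

Let J01 x : J x -> 0 <= x <= 1.
Proof.
rewrite /= in_itv/= => /andP[-> x2]; rewrite (le_trans x2)//.
by rewrite ler_pdivrMr// mul1r ler1n.
Qed.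

Let J01' x : J x -> 0 <= 1 - x <= 1.
Proof. by move=> /J01/andP[x0 x1]; rewrite subr_ge0 x1 gerBl. Qed.

Let wE k x : (2 <= k)%N -> J x -> w k x + w k (1 - x) =
  (digit_weight k x * f (k%:R + x)^-1 +
   digit_weight k (1 - x) * f (k%:R + (1 - x))^-1) * density_o x.
Proof.
move=> k2 Jx.
have wkE z : w k z = f (k%:R + z)^-1 * (density_o (k%:R + z)^-1 / (k%:R + z) ^+ 2).
  by rewrite mulrA.
rewrite !wkE !density_o_branch ?J01' ?J01// density_oE//.
have -> : (G + (1 - x)) * (G + 1 - (1 - x)) = (G + x) * (G + 1 - x) by ring.
by ring.
Qed.

Let lw k : (2 <= k)%N -> lip J (fun x => w k x) /\ lip J (fun x => w k (1 - x)).
Proof.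
move=> k2; have k2R : 2 <= k%:R :> R by rewrite ler_nat.
pose I := `[0, 1]%classic : set R.
have li : lip I (fun x => (k%:R + x)^-1).
  apply: lip_shift_inv; left; rewrite addr0; lra.
have lw : lip I (w k).
  apply: lipM.
    apply: (lip_comp _ li lF) => x; rewrite /I /= !in_itv/= => /andP[x0 _].
    by have := inverse_branch_itv k2 x0; rewrite /= in_itv.
  apply: eq_lip (lipM li li) => x _.
  by rewrite -expr2 exprVn.
split; first by apply: lipS lw => x /J01; rewrite /I /= in_itv.
apply: (lip_comp _ _ lw) => [x /J01'|]; first by rewrite /I /= in_itv.
by apply: lipD; [exact: lip_cst|apply: lipN; exact: lip_id].
Qed.

(** The interval between [1/(N + 1)] and [1/N] is cut at [1/(N + 1/2)], where the nearest integer to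
    [1/x] changes. The right piece has digit [N] and image [0, 1/2]; the left one has digit [N + 1]
    and image [-1/2, 0], folded back by the symmetry of [A]. *)
Lemma Rintegral_digit N : (2 <= N)%N ->
  \int[mu]_(x in `[0, N%:R^-1] `&` T_o @^-1` A) F x =
  \int[mu]_(x in `[0, N.+1%:R^-1] `&` T_o @^-1` A) F x +
  \int[mu]_(x in J `&` A) (w N x + w N (1 - x)).
Proof.
move=> N2; have N2R : 2 <= N%:R :> R by rewrite ler_nat.
have mTA : measurable (T_o @^-1` A) by exact: (@measurable_preimage_T_o _ 1).
have N0 : 0 < N%:R :> R by lra.
have N10 : 0 < N%:R + 1 :> R by lra.
have N20 : 0 < N%:R + 1 / 2 :> R by lra.
have le12 : (N%:R + 1)^-1 <= (N%:R + 1 / 2)^-1 :> R by rewrite lef_pV2 ?posrE//; lra.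
have le23 : (N%:R + 1 / 2)^-1 <= N%:R^-1 :> R by rewrite lef_pV2 ?posrE//; lra.
have sub : `[0, N%:R^-1] `<=` J.
  move=> x /=; rewrite !in_itv/= => /andP[-> xN]; rewrite (le_trans xN)//.
  by rewrite div1r lef_pV2 ?posrE.
have lFN : lip `[0, N%:R^-1] F by exact: lipS sub lF.
rewrite (@Rintegral_itv_split _ _ (N.+1%:R^-1))//; last first.
  by rewrite lef_pV2 ?posrE// ler_nat.
congr (_ + _).
rewrite -(natr1 N) (@Rintegral_itv_split _ _ (N%:R + 1 / 2)^-1)//; last first.
  by apply: lipS lFN; apply: subset_itvr; rewrite bnd_simp invr_ge0 ltW.
have [lw1 lw2] := lw N2.
rewrite RintegralD//; last 3 first.
- exact: mJ.
- by apply: lip_integrable lw1 _ _; [exact: mJ|exact: subIsetl].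
- by apply: lip_integrable lw2 _ _; [exact: mJ|exact: subIsetl].
rewrite addrC; congr (_ + _).
  have := @ge0_integral_branch R F (Posz N) 0 (1 / 2) A; rewrite addr0; apply => //.
  - by left; lra.
  - by apply: lipS lFN; apply: subset_itvr; rewrite bnd_simp invr_ge0 ltW.
  - move=> x h1 h2; apply: F0; apply: sub; rewrite /= in_itv/= h2 andbT.
    by apply: le_trans h1; rewrite invr_ge0 ltW.
have := @ge0_integral_branch R F (Posz N.+1) (- (1 / 2)) 0 A.
rewrite addr0 -[(Posz N.+1)%:~R]/(N.+1%:R) -(natr1 N).
have lFN' : lip `[(N%:R + 1)^-1, (N%:R + 1 / 2)^-1] F.
  apply: lipS lFN => x /=; rewrite !in_itv/= => /andP[x1 x2].
  by rewrite (le_trans x2)// andbT (le_trans _ x1)// invr_ge0 ltW.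
have F0' x : (N%:R + 1)^-1 <= x -> x <= (N%:R + 1 / 2)^-1 -> 0 <= F x.
  move=> x1 x2; apply: F0; apply: sub; rewrite /= in_itv/= (le_trans x2)// andbT.
  by apply: le_trans x1; rewrite invr_ge0 ltW.
have n20 : - (1 / 2) <= 0 :> R by lra.
have n21 : (1 <= N%:R + 1 / 2 :> R) \/ (N%:R + 1 <= -1 :> R) by left; lra.
have -> : N%:R + 1 - 1 / 2 = N%:R + 1 / 2 :> R by lra.
move=> /(_ (lexx _) n20) ->//.
pose g y := F (N%:R + 1 + y)^-1 / (N%:R + 1 + y) ^+ 2.
have gE y : g y = w N (1 - - y) by rewrite /g /w opprK addrA.
have lg : lip `[- (1 / 2), - 0] g.
  apply: (@eq_lip _ _ (fun y => w N (1 - - y))) => [y _|]; first by rewrite gE.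
  apply: (lip_comp _ (lipN (lip_id _)) lw2) => y.
  by rewrite /= !in_itv/= oppr0 oppr_ge0 lerNl andbC.
have := @Rintegral_reflection g 0 (1 / 2) A; rewrite oppr0 in lg *.
move=> ->//.
  by apply: eq_Rintegral => x _; rewrite gE opprK.
move=> x x1 x2; rewrite mulr_ge0 ?invr_ge0 ?sqr_ge0// F0//.
by rewrite -addrA; apply: (inverse_branch_itv N2); lra.
Qed.

Lemma lip_branch_sum N : (2 <= N)%N ->
  lip J (fun x => (branch_sum N f x + branch_sum N f (1 - x)) * density_o x).
Proof.
elim: N => // N IH; rewrite ltnS leq_eqVlt => /predU1P[<-|N2].
  by apply: (eq_lip _ (lip_cst _ 0)) => x _; rewrite /branch_sum !big_geq// addr0 mul0r.
have [lw1 lw2] := lw N2.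
apply: (eq_lip _ (lipD (IH N2) (lipD lw1 lw2))) => x Jx.
by rewrite /branch_sum !big_nat_recr//= wE// -mulrDl addrACA.
Qed.

Lemma Rintegral_preimage_T_o N : (2 <= N)%N ->
  \int[mu]_(x in J `&` T_o @^-1` A) F x =
  \int[mu]_(x in `[0, N%:R^-1] `&` T_o @^-1` A) F x +
  \int[mu]_(x in J `&` A)
    ((branch_sum N f x + branch_sum N f (1 - x)) * density_o x).
Proof.
elim: N => // N IH; rewrite ltnS leq_eqVlt => /predU1P[<-|N2].
  (* At [N = 2] the branch sums are empty and the remaining interval is all of [0, 1/2]. *)
  rewrite div1r [X in _ + X](_ : _ = 0) ?addr0//.
  rewrite (@eq_Rintegral _ _ _ mu _ (fun=> 0)); last first.
    by move=> x _; rewrite /branch_sum !big_geq// addr0 mul0r.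
  by rewrite Rintegral_cst ?mul0r//; apply: measurableI => //; exact: measurable_itv.
rewrite IH// Rintegral_digit// -addrA; congr (_ + _).
have [lw1 lw2] := lw N2.
rewrite -RintegralD//; last 3 first.
- exact: mJ.
- by apply: lip_integrable (lipD lw1 lw2) _ _; [exact: mJ|exact: subIsetl].
- by apply: lip_integrable (lip_branch_sum N2) _ _; [exact: mJ|exact: subIsetl].
apply: eq_Rintegral => x /set_mem[Jx _].
by rewrite /branch_sum !big_nat_recr//= wE// -mulrDl; congr (_ * _); ring.
Qed.

End one_step.

Lemma Rintegral_norm_le g a b (M : R) B : a <= b -> lip `[a, b] g ->
  measurable B -> B `<=` `[a, b] -> (forall x, B x -> `|g x| <= M) -> 0 <= M ->
  `|\int[mu]_(x in B) g x| <= M * (b - a).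
Proof.
move=> ab lg mB Bab gM M0.
have ig : mu.-integrable B (EFin \o g) by exact: lip_integrable lg _ _.
apply: le_trans (@le_normr_Rintegral _ _ _ mu B g mB ig) _.
have muI : (mu `[a, b] = (b - a)%:E)%E.
  rewrite lebesgue_measure_itv/= lte_fin; case: ltgtP ab => // -> _.
  by rewrite subrr.
have muB : (mu B <= (b - a)%:E)%E by rewrite -muI le_measure// inE.
have muB_fin : mu B \is a fin_num.
  by rewrite ge0_fin_numE// (le_lt_trans muB)// ltry.
apply: (@le_trans _ _ (\int[mu]_(x in B) M)); last first.
  rewrite Rintegral_cst// ler_wpM2l// -[b - a]/(fine (b - a)%:E).
  by rewrite fine_le.
apply: le_Rintegral => //; first exact: integrable_norm.
apply: lip_integrable (lip_cst _ M) mB Bab.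
Qed.

(** Two errors of order [1/N] arise: the integral over [[0, 1/N]] and the discarded mass sent to
    1/4. The constant does not depend on [A], so preimages under any iterate may be inserted. *)
Lemma transfer_approximation f : lip J f -> (forall x, J x -> 0 <= f x) ->
  exists2 C, 0 <= C & forall N A, (9 <= N)%N -> measurable A -> symmetric_set A ->
    `|\int[mu]_(x in J `&` T_o @^-1` A) (f x * density_o x) -
      \int[mu]_(x in J `&` A) (truncated_transfer N f x * density_o x)| <=
    C / (N%:R - 1).
Proof.
move=> lf f0.
have ld : lip J density_o by exact: lipS right_half_sub lip_density_o.
have lF : lip J (fun x => f x * density_o x) by exact: lipM.
have [M M0 FM] := lip_bounded lF.
have [D D0 dD] := lip_bounded ld.
have J4 : J (1 / 4) by rewrite /= in_itv/=; apply/andP; split; lra.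
have f40 := f0 _ J4.
(* The 3 is twice the tail constant 3 of [digit_tail_le], times the length 1/2 of the interval. *)
exists (M + 3 * f (1 / 4) * D) => [|N A N9 mA sA]; first by rewrite addr_ge0// !mulr_ge0.
have N2 : (2 <= N)%N by exact: leq_trans N9.
have N1 : 0 < N%:R - 1 :> R by rewrite subr_gt0 ltr1n.
have N0 : 0 < N%:R :> R by rewrite ltr0n (leq_trans _ N2).
have lV : lip J (fun x => truncated_transfer N f x * density_o x).
  apply: lipM => //; case: lf => L L0 Lf.
  exists (contraction_rate * L); last exact: klip_truncated_transfer.
  by rewrite mulr_ge0// ltW// contraction_rate_gt0.
have lU := lip_branch_sum lf N2.
rewrite (Rintegral_preimage_T_o lf f0 mA sA N2) -addrA mulrDl.
apply: le_trans (ler_normD _ _) _; apply: lerD.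
  have sub : `[0, N%:R^-1] `&` T_o @^-1` A `<=` `[0, N%:R^-1] by exact: subIsetl.
  have subJ : `[0, N%:R^-1] `<=` J.
    move=> x /=; rewrite !in_itv/= => /andP[-> xN]; rewrite (le_trans xN)//.
    by rewrite div1r lef_pV2 ?posrE// ler_nat.
  apply: le_trans (@Rintegral_norm_le _ 0 N%:R^-1 M _ _ (lipS subJ lF) _ sub _ M0) _.
  - by rewrite invr_ge0 ltW.
  - apply: measurableI; first exact: measurable_itv.
    exact: (@measurable_preimage_T_o _ 1).
  - by move=> x [/subJ + _]; exact: FM.
  - by rewrite subr0 ler_wpM2l// lef_pV2 ?posrE// gerBl.
have sub : J `&` A `<=` J by exact: subIsetl.
rewrite -RintegralB; [|exact: mJ|exact: lip_integrable lU (mJ mA) sub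
  |exact: lip_integrable lV (mJ mA) sub].
have K0 : 0 <= 6 * f (1 / 4) * D / (N%:R - 1).
  by rewrite divr_ge0 ?(ltW N1)// !mulr_ge0.
have half : 0 <= 1 / 2 :> R by rewrite divr_ge0.
have lB := lipD lU (lipN lV).
apply: le_trans (@Rintegral_norm_le _ 0 (1 / 2) _ _ half lB (mJ mA) sub _ K0) _.
  move=> x [Jx _]; rewrite -mulrBl -[_ - truncated_transfer _ _ _]opprB.
  have x01 : 0 <= x <= 1.
    move: (Jx); rewrite /= in_itv/= => /andP[-> x2]; rewrite (le_trans x2)//.
    by rewrite ler_pdivrMr// mul1r ler1n.
  have x01' : 0 <= 1 - x <= 1 by move: x01 => /andP[x0 x1]; rewrite subr_ge0 x1 gerBl.
  rewrite truncated_transferB// mulNr normrN normrM.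
  rewrite ger0_norm; last by rewrite mulr_ge0// addr_ge0 ?digit_tail_ge0.
  have := digit_tail_le N2 x01; have := digit_tail_le N2 x01' => h1 h2.
  have -> : 6 * f (1 / 4) * D / (N%:R - 1) =
    f (1 / 4) * (3 / (N%:R - 1) + 3 / (N%:R - 1)) * D by ring.
  apply: ler_pM; rewrite ?dD// ?mulr_ge0 ?addr_ge0 ?digit_tail_ge0//.
  by rewrite ler_wpM2l// lerD.
by rewrite le_eqVlt; apply/orP; left; apply/eqP; field; rewrite (gt_eqF N1).
Qed.

End folded_transfer.

(** * Exponential decay for Lipschitz densities on [0, 1/2] *)

Section decay.
Context {R : realType}.
Implicit Types (x y a b c L : R) (f : R -> R) (k n N : nat) (A E B S : set R).
Notation mu := (@lebesgue_measure R).
Local Notation J := (`[0, 1 / 2]%classic : set R).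
Local Notation J' := (`[- (1 / 2), 0]%classic : set R).
Local Notation U := (`[-1, 1]%classic : set R).
Local Notation T := (@T_o R).
Local Notation q := (@contraction_rate R).

Lemma left_half_sub : J' `<=` U.
Proof. by move=> x; rewrite /= !in_itv/= => /andP[x0 x2]; apply/andP; split; lra. Qed.

Lemma I_o_sub : @I_o R `<=` U.
Proof. by move=> x; rewrite /I_o /= !in_itv/= => /andP[x0 x2]; apply/andP; split; lra. Qed.

Lemma mu_oE A : measurable (@I_o R `&` A) -> mu_o A = (\int[mu]_(x in @I_o R `&` A) density_o x)%:E.
Proof.
move=> mIA; rewrite /mu_o setIC /Rintegral fineK//.
apply: integrable_fin_num => //; apply: lip_integrable lip_density_o mIA _.
by move=> x [/I_o_sub].
Qed.

Lemma mu_o_symmetric A : measurable A -> symmetric_set A ->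
  mu_o A = (2 * \int[mu]_(x in J `&` A) density_o x)%:E.
Proof.
move=> mA sA; rewrite mu_oE; last by apply: measurableI => //; exact: measurable_I_o.
congr EFin.
have h0 : - (1 / 2) <= 0 :> R by lra.
have h1 : 0 <= 1 / 2 :> R by lra.
rewrite /I_o (Rintegral_itv_split h0 h1 (lipS I_o_sub lip_density_o) mA).
rewrite -[X in `[_, X] `&` A]oppr0 Rintegral_reflection//; last 2 first.
- by rewrite oppr0; exact: lipS left_half_sub lip_density_o.
- move=> x x1 x2; apply: density_o_ge0_unit; apply: left_half_sub; rewrite /= in_itv/= x1.
  by rewrite -oppr0.
rewrite mulr_natl mulr2n; congr (_ + _).
by apply: eq_Rintegral => x _; rewrite /density_o normrN.
Qed.

Let mJA A : measurable A -> measurable (J `&` A).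
Proof. by move=> mA; apply: measurableI => //; exact: measurable_itv. Qed.

Let ld : lip J density_o. Proof. exact: lipS right_half_sub lip_density_o. Qed.

Let d0 x : J x -> 0 <= @density_o R x.
Proof. by move=> /right_half_sub; exact: density_o_ge0_unit. Qed.

Lemma Rintegral_density_o : \int[mu]_(x in J) density_o x = 1 / 2.
Proof.
have := @mu_o_symmetric setT measurableT (fun _ _ => I).
rewrite (@probability_setT _ _ _ (@mu_o R)) setIT => -[].
by set z := \int[mu]_(x in _) _ => h; lra.
Qed.

Lemma Rintegral_density_o_itv A : measurable A ->
  0 <= \int[mu]_(x in J `&` A) density_o x <= 1 / 2.
Proof.
move=> mA; apply/andP; split; first by apply: Rintegral_ge0 => x [/d0].
rewrite -[leRHS]Rintegral_density_o; apply: fine_le.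
- apply: integrable_fin_num; first exact: (mJA mA).
  by apply: lip_integrable ld (mJA mA) _; exact: subIsetl.
- apply: integrable_fin_num; first exact: measurable_itv.
  exact: lip_integrable ld (measurable_itv _) _.
- apply: ge0_subset_integral => //; first exact: (mJA mA).
  by apply/measurable_EFinP; exact: lip_measurable ld _ _.
Qed.

(** Induction on [n]: one step replaces [f] by its truncated transfer, with Lipschitz constant
    [q * L], up to an error that vanishes as [N] grows. The factor [2 * e] in the proof is the
    [mu_o] measure of [E]. *)
Lemma decay_folded n L f E : 0 <= L -> klip L J f -> (forall x, J x -> 0 <= f x) ->
  measurable E -> symmetric_set E ->
  `|\int[mu]_(x in J `&` iter n T @^-1` E) (f x * density_o x) -
    2 * \int[mu]_(x in J `&` E) density_o x * \int[mu]_(x in J) (f x * density_o x)|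
  <= L * q ^+ n.
Proof.
move=> L0 Lf f0 mE sE.
have := Rintegral_density_o_itv mE.
set e := \int[mu]_(x in J `&` E) _ => /andP[e0 e2].
elim: n L f L0 Lf f0 => [|n IH] L f L0 Lf f0.
  (* The constant [f 0] cancels. The rest is at most [L / 2], integrated against mass at most 1/2,
     so each of the two remaining terms is at most [L / 4]. *)
  rewrite expr0 mulr1 /=.
  pose r x := f x - f 0.
  have J0 : J 0 by rewrite /= in_itv/= lexx divr_ge0.
  have lf : lip J f by exists L.
  have lr : lip J r by apply: lipD => //; exact: lip_cst.
  have split A : measurable A -> \int[mu]_(x in J `&` A) (f x * density_o x) =
      f 0 * \int[mu]_(x in J `&` A) density_o x +
      \int[mu]_(x in J `&` A) (r x * density_o x).
    move=> mA; have JA : J `&` A `<=` J by exact: subIsetl.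
    rewrite -RintegralZl; [|exact: mJA|exact: lip_integrable ld (mJA mA) JA].
    rewrite -RintegralD; [|exact: mJA| |]; last 2 first.
    - exact: lip_integrable (lipM (lip_cst _ _) ld) (mJA mA) JA.
    - exact: lip_integrable (lipM lr ld) (mJA mA) JA.
    by apply: eq_Rintegral => x _; rewrite /r; ring.
  have bound A : measurable A -> `|\int[mu]_(x in J `&` A) (r x * density_o x)| <= L / 4.
    move=> mA; have JA : J `&` A `<=` J by exact: subIsetl.
    have ir := lip_integrable (lipM lr ld) (mJA mA) JA.
    apply: le_trans (@le_normr_Rintegral _ _ _ mu _ _ (mJA mA) ir) _.
    have /andP[_ h] := Rintegral_density_o_itv mA.
    apply: (@le_trans _ _ (L / 2 * \int[mu]_(x in J `&` A) density_o x)); last first.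
      apply: le_trans (ler_wpM2l _ h) _; first by rewrite divr_ge0.
      by rewrite le_eqVlt; apply/orP; left; apply/eqP; field.
    rewrite -RintegralZl; [|exact: mJA|exact: lip_integrable ld (mJA mA) JA].
    apply: le_Rintegral; first exact: (mJA mA).
    - exact: (integrable_norm ir).
    - exact: lip_integrable (lipM (lip_cst _ _) ld) (mJA mA) JA.
    move=> x [Jx _]; rewrite normrM (ger0_norm (d0 Jx)) ler_wpM2r ?d0//.
    apply: le_trans (Lf _ _ Jx J0) _; rewrite ler_wpM2l// subr0.
    by move: Jx; rewrite /= in_itv/= => /andP[x0 x2]; rewrite ger0_norm// -div1r.
  have := split setT measurableT; have := bound setT measurableT.
  rewrite setIT => b1 ->; rewrite split// -/e Rintegral_density_o.
  have := bound E mE; move: b1.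
  set u := \int[mu]_(x in J) _; set v := \int[mu]_(x in J `&` E) _ => b1 b2.
  have -> : f 0 * e + v - 2 * e * (f 0 * (1 / 2) + u) = v - 2 * e * u by field.
  apply: le_trans (ler_normB _ _) _.
  have : `|2 * e * u| <= 1 * (L / 4).
    rewrite normrM ler_pM//; rewrite ger0_norm; lra.
  by lra.
have lf : lip J f by exists L.
have [C C0 approx] := transfer_approximation lf f0.
rewrite (_ : iter n.+1 T @^-1` E = T @^-1` (iter n T @^-1` E)); last first.
  by apply/funext => x; rewrite /preimage/= -iterSr.
have mEn := measurable_preimage_T_o n mE.
have sEn : symmetric_set (iter n T @^-1` E) by exact: symmetric_iter_T_o.
apply/ler_addgt0Pr => eps eps0.
(* The truncation level is chosen after [eps], so that each of the two approximations costs at most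
   [eps / 2]; the 9 meets the threshold of the contraction. *)
pose N := (9 + (Num.truncn (2 * C / eps)%R).+1)%N.
have N9 : (9 <= N)%N by rewrite leq_addr.
have N2 : (2 <= N)%N by exact: leq_trans N9.
have N1 : 0 < N%:R - 1 :> R by rewrite subr_gt0 ltr1n.
have Ceps : C / (N%:R - 1) <= eps / 2.
  have NE : N%:R - 1 = (Num.truncn (2 * C / eps)).+1%:R + 8 :> R.
    by rewrite /N natrD; ring.
  have := truncnS_gt (2 * C / eps); rewrite ltr_pdivrMr// => h.
  rewrite ler_pdivrMr// NE.
  set t := _%:R in h *; have : 0 <= eps * 8 by rewrite mulr_ge0// ltW.
  by lra.
have qL0 : 0 <= q * L by rewrite mulr_ge0// ltW// contraction_rate_gt0.
have V0 x : J x -> 0 <= truncated_transfer N f x.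
  move=> Jx; apply: truncated_transfer_ge0 => //.
  by move: Jx; rewrite /= in_itv/= => /andP[x0 x2]; apply/andP; split; lra.
have := IH (q * L) (truncated_transfer N f) qL0 (klip_truncated_transfer N9 L0 Lf) V0.
have := approx N _ N9 mEn sEn.
(* The whole line is needed too, because the truncated operator preserves the total integral only
   approximately. *)
have := approx N setT N9 measurableT (fun _ _ => I).
rewrite preimage_setT !setIT.
set a1 := \int[mu]_(x in J) _; set a2 := \int[mu]_(x in J) _.
set a3 := \int[mu]_(x in _) _; set a4 := \int[mu]_(x in _) _ => h1 h2 h3.
have -> : a3 - 2 * e * a1 = (a3 - a4) + (a4 - 2 * e * a2) - 2 * e * (a1 - a2) by ring.
have e21 : `|2 * e| <= 1 by rewrite ger0_norm; lra.
have h4 : `|2 * e * (a1 - a2)| <= eps / 2.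
  rewrite normrM -[eps / 2]mul1r ler_pM//; exact: le_trans Ceps.
apply: le_trans (ler_normB _ _) _.
have -> : L * q ^+ n.+1 + eps = eps / 2 + q * L * q ^+ n + eps / 2.
  by rewrite exprS; field.
apply: lerD h4; apply: le_trans (ler_normD _ _) _.
by apply: lerD h3; exact: le_trans Ceps.
Qed.

End decay.

(** * Reduction of cylinders to intervals, one digit at a time *)

Section cylinders.
Context {R : realType}.
Implicit Types (x y a b c L : R) (f : R -> R) (n N : nat) (A E B S : set R) (k : int).
Notation mu := (@lebesgue_measure R).
Local Notation G := (@golden R).
Local Notation J := (`[0, 1 / 2]%classic : set R).
Local Notation J' := (`[- (1 / 2), 0]%classic : set R).
Local Notation U := (`[-1, 1]%classic : set R).
Local Notation T := (@T_o R).
Local Notation q := (@contraction_rate R).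

(* Densities are taken on [-1, 1] because this interval, unlike [I_o], is mapped
   into itself by every inverse branch [y |-> 1 / (k + y)] with [2 <= |k|]. *)
Definition decays S := forall f, lip U f -> (forall x, U x -> 0 <= f x) ->
  exists2 C, 0 <= C & forall n E, measurable E -> symmetric_set E ->
    `|\int[mu]_(x in S `&` iter n T @^-1` E) f x -
      fine (mu_o E) * \int[mu]_(x in S) f x| <= C * q ^+ n.

(** Dividing [f] by the invariant density, whose reciprocal is a polynomial on [0, 1/2], gives a
    Lipschitz [g] to which the decay for the folded map applies. *)
Lemma decays_right : decays J.
Proof.
move=> f lf f0.
have g1 := @golden_gt1 R; have l0 := @ln_golden_gt0 R.
have a0 : 0 < 2 * G + 1 by lra.
pose g x := f x * (2 * ln G * ((G + x) * (G + 1 - x) / (2 * G + 1))).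
have JG x : J x -> 0 < G + x /\ 0 < G + 1 - x.
  by rewrite /= in_itv/= => /andP[x0 x2]; split; lra.
have [L L0 Lg] : lip J g.
  apply: lipM; first exact: lipS right_half_sub lf.
  apply: lipM; first exact: lip_cst.
  apply: lipM; last exact: lip_cst.
  apply: lipM; apply: lipD; try exact: lip_cst; first exact: lip_id.
  by apply: lipN; exact: lip_id.
have g0 x : J x -> 0 <= g x.
  move=> Jx; have [h1 h2] := JG _ Jx; rewrite mulr_ge0 ?f0//; first exact: right_half_sub.
  by rewrite mulr_ge0 ?divr_ge0 ?mulr_ge0 ?(ltW h1) ?(ltW h2) ?(ltW a0) ?(ltW l0).
have gE x : J x -> g x * density_o x = f x.
  move=> Jx; have [h1 h2] := JG _ Jx; rewrite density_oE// /g; field.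
  by rewrite (gt_eqF h1) (gt_eqF h2) (gt_eqF a0) (gt_eqF l0).
exists L => // n E mE sE; have := decay_folded n L0 Lg g0 mE sE.
rewrite mu_o_symmetric//=.
have -> : \int[mu]_(x in J) (g x * density_o x) = \int[mu]_(x in J) f x.
  by apply: eq_Rintegral => x /set_mem; exact: gE.
have -> // : \int[mu]_(x in J `&` iter n T @^-1` E) (g x * density_o x) =
    \int[mu]_(x in J `&` iter n T @^-1` E) f x.
by apply: eq_Rintegral => x /set_mem[Jx _]; exact: gE.
Qed.

Lemma decays_left : decays J'.
Proof.
move=> f lf f0.
have UN x : U x -> U (- x) by rewrite /= !in_itv/= lerN2 lerNl andbC.
have lfN : lip U (fun x => f (- x)) by apply: lip_comp (lipN (lip_id _)) lf.
have f0N x : U x -> 0 <= f (- x) by move=> /UN; exact: f0.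
have [C C0 dec] := decays_right lfN f0N.
have half : 0 <= 1 / 2 :> R by lra.
have refl A : measurable A -> symmetric_set A ->
    \int[mu]_(x in J' `&` A) f x = \int[mu]_(x in J `&` A) f (- x).
  move=> mA sA; rewrite -[X in `[_, X]]oppr0 Rintegral_reflection// oppr0.
    exact: lipS left_half_sub lf.
  by move=> x x0 x2; apply: f0; apply: left_half_sub; rewrite /= in_itv/= x0.
exists C => // n E mE sE.
rewrite refl; [|exact: measurable_preimage_T_o|exact: symmetric_iter_T_o].
have := refl setT measurableT (fun _ _ => I); rewrite !setIT => ->.
exact: dec.
Qed.

Lemma decays0 : decays set0.
Proof.
move=> f _ _; exists 0 => // n E _ _.
by rewrite set0I !Rintegral_set0 mulr0 subrr normr0 mul0r.
Qed.

Lemma decays_split a b c S : -1 <= a -> a <= b -> b <= c -> c <= 1 -> measurable S ->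
  decays (`[a, b] `&` S) -> decays (`[b, c] `&` S) -> decays (`[a, c] `&` S).
Proof.
move=> a1 ab bc c1 mS d1 d2 f lf f0.
have [C1 C10 dec1] := d1 f lf f0; have [C2 C20 dec2] := d2 f lf f0.
have lac : lip `[a, c] f.
  apply: lipS lf => x /=; rewrite !in_itv/= => /andP[ax xc].
  by rewrite (le_trans a1)// (le_trans xc).
exists (C1 + C2) => [|n E mE sE]; first exact: addr_ge0.
have mSE : measurable (S `&` iter n T @^-1` E).
  by apply: measurableI => //; exact: measurable_preimage_T_o.
rewrite -setIA (Rintegral_itv_split ab bc lac mSE) (Rintegral_itv_split ab bc lac mS).
have := dec1 n E mE sE; have := dec2 n E mE sE; rewrite -!setIA => h1 h2.
rewrite mulrDr opprD addrACA mulrDl; apply: le_trans (ler_normD _ _) _.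
exact: lerD.
Qed.

Lemma fine_mu_o_itv E : measurable E -> symmetric_set E -> 0 <= fine (mu_o E) <= 1.
Proof.
move=> mE sE; rewrite mu_o_symmetric//=.
by have /andP[h1 h2] := Rintegral_density_o_itv mE; apply/andP; split; lra.
Qed.

Lemma intr_norm_ge2 k : 2 <= `|k| -> (2 <= k%:~R :> R) \/ (k%:~R <= -2 :> R).
Proof.
have [kp|kn] := leP 0 k => k2; [left|right].
  by rewrite ger0_norm// -(ler_int R) in k2.
by rewrite ltr0_norm// lerNr -(ler_int R) mulrNz in k2.
Qed.

(** Substituting along the branch turns the preimage under [n + 1] iterates into one under [n]. The
    lost step costs a factor [1 / q] in the constant, and [4 * M] covers [n = 0] by a crude
    bound. *)
Lemma decays_branch k a b S : 2 <= `|k| -> - (1 / 2) <= a -> a <= b -> b <= 1 / 2 ->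
  measurable S -> decays (`[a, b] `&` S) ->
  decays (`[(k%:~R + b)^-1, (k%:~R + a)^-1] `&` T @^-1` S).
Proof.
move=> k2 a2 ab b2 mS dec f lf f0.
have kU : (1 <= k%:~R + (-1) :> R) \/ (k%:~R + 1 <= -1 :> R).
  by have [h|h] := intr_norm_ge2 k2; [left|right]; lra.
have kab : 1 <= k%:~R + a \/ k%:~R + b <= -1 by case: kU => h; [left|right]; lra.
have lu := lip_shift_inv kU.
have uU y : U y -> U (k%:~R + y)^-1.
  rewrite /= !in_itv/= => /andP[y1 y2]; rewrite -ler_norml normfV.
  have h : 1 <= `|k%:~R + y|.
    by rewrite ler_normr; apply/orP; case: kU => h; [left|right]; lra.
  by rewrite invf_le1 ?(lt_le_trans _ h).
pose g y := f (k%:~R + y)^-1 / (k%:~R + y) ^+ 2.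
have lg : lip U g.
  apply: lipM; first exact: lip_comp uU lu lf.
  by apply: eq_lip (lipM lu lu) => x _; rewrite -expr2 exprVn.
have g0 y : U y -> 0 <= g y.
  by move=> Uy; rewrite mulr_ge0 ?invr_ge0 ?sqr_ge0// f0//; exact: uU.
set K := `[_, _]%classic.
have KU : K `<=` U.
  move=> x; rewrite /K /= in_itv/= => Kx.
  have /andP[ax xb] : a <= x^-1 - k%:~R <= b.
    by apply: shift_inv_itv Kx => //; case: kab => ?; [left|right]; lra.
  have := uU (x^-1 - k%:~R); rewrite /= !in_itv/= [_ + (_ - _)]addrC subrK invrK.
  by apply; apply/andP; split; lra.
have branch A : measurable A ->
    \int[mu]_(x in K `&` T @^-1` A) f x = \int[mu]_(y in `[a, b] `&` A) g y.
  move=> mA; rewrite ge0_integral_branch//; first exact: lipS KU lf.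
  by move=> x x1 x2; apply: f0; apply: KU; rewrite /K /= in_itv/= x1.
have [C C0 decg] := dec g lg g0.
have [M M0 fM] := lip_bounded lf.
have M4 : 0 <= 4 * M by rewrite mulr_ge0.
have Cq : 0 <= C / q by exact: divr_ge0 C0 (ltW contraction_rate_gt0).
exists (C / q + 4 * M) => [|n E mE sE]; first exact: addr_ge0.
have mKS : measurable (K `&` T @^-1` S).
  apply: measurableI; first exact: measurable_itv.
  exact: (@measurable_preimage_T_o _ 1).
case: n => [|n].
  have mKSE : measurable (K `&` T @^-1` S `&` E) by exact: measurableI.
  have le11 : -1 <= 1 :> R by lra.
  have bSE : `|\int[mu]_(x in K `&` T @^-1` S `&` E) f x| <= M * (1 - -1).
    by apply: Rintegral_norm_le le11 lf mKSE _ _ M0 => x [[/KU Ux _] _] //; exact: fM.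
  have bS : `|\int[mu]_(x in K `&` T @^-1` S) f x| <= M * (1 - -1).
    by apply: Rintegral_norm_le le11 lf mKS _ _ M0 => x [/KU Ux _] //; exact: fM.
  have /andP[m0 m1] := fine_mu_o_itv mE sE.
  rewrite expr0 mulr1; apply: le_trans (ler_normB _ _) _; rewrite normrM ger0_norm//.
  have -> : C / q + 4 * M = C / q + (M * (1 - -1) + 1 * (M * (1 - -1))) by ring.
  apply: (ler_wpDl Cq).
  by apply: lerD => //; exact: ler_pM.
rewrite -setIA (_ : T @^-1` S `&` iter n.+1 T @^-1` E = T @^-1` (S `&` iter n T @^-1` E)); last first.
  by apply/seteqP; split => x []; rewrite /preimage/= -iterSr.
have mn := measurable_preimage_T_o n mE.
rewrite !branch//; last exact: measurableI.
rewrite setIA; apply: le_trans (decg n E mE sE) _.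
have qn0 : 0 <= q ^+ n by exact: exprn_ge0 (ltW contraction_rate_gt0).
rewrite exprS mulrA; apply: (ler_wpM2r qn0).
rewrite mulrDl (divfK (lt0r_neq0 contraction_rate_gt0)) lerDl.
exact: mulr_ge0 M4 (ltW contraction_rate_gt0).
Qed.

(** The point [1 / (k + y)] lies in [I_o] exactly when [k + y] has modulus at least 2; the last
    hypothesis describes the [y] for which this happens. *)
Lemma digit_cylinder_itv k a b : 2 <= `|k| -> - (1 / 2) <= a -> a <= b -> b <= 1 / 2 ->
  (0 < k%:~R + a :> R) \/ (k%:~R + b < 0 :> R) ->
  (forall y, - (1 / 2) <= y <= 1 / 2 -> (2 <= `|k%:~R + y|) = (a <= y <= b)) ->
  digit_cylinder k = `[(k%:~R + b)^-1, (k%:~R + a)^-1]%classic.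
Proof.
move=> k2 a2 ab b2 k0 dom.
have Io (z : R) : z != 0 -> I_o z^-1 <-> 2 <= `|z|.
  move=> z0; have z0' : 0 < `|z| by rewrite normr_gt0.
  rewrite /I_o /= in_itv/= -ler_norml normfV div1r.
  by rewrite lef_pV2 ?posrE.
apply/seteqP; split => x.
  move=> [[y Iy <-]]; rewrite div1r => Ix; move: (Iy); rewrite {1}/I_o /= in_itv/= => y2.
  have ky0 : k%:~R + y != 0.
    move: y2 => /andP[y1 y2].
    by have [k2R|k2R] := intr_norm_ge2 k2; [rewrite gt_eqF|rewrite lt_eqF]; lra.
  have := (Io _ ky0).1 Ix; rewrite dom// in_itv/= => /andP[ay yb].
  case: k0 => k0.
    by rewrite !lef_pV2 ?posrE ?lerD2l ?ay ?yb//; lra.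
  by rewrite !lef_nV2 ?negrE ?lerD2l ?ay ?yb//; lra.
rewrite /= in_itv/= => Kx; have aby := shift_inv_itv ab k0 Kx.
have /andP[ay yb] := aby.
set y := x^-1 - k%:~R in aby ay yb.
have xE : x = (k%:~R + y)^-1 by rewrite /y addrC subrK invrK.
have y2 : - (1 / 2) <= y <= 1 / 2 by rewrite (le_trans a2)// (le_trans yb).
have ky0 : k%:~R + y != 0 by case: k0 => k0; [rewrite gt_eqF|rewrite lt_eqF]; lra.
split; first by exists y; [rewrite /I_o /= in_itv|rewrite div1r xE].
by rewrite xE; apply/(Io _ ky0); rewrite dom.
Qed.

(** Only for the digits 2 and -2 does [I_o] cut the branch, and it leaves exactly one half of the
    range of [y]. *)
Lemma digit_cylinder_cases k : 2 <= `|k| -> exists a b,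
  digit_cylinder k = `[(k%:~R + b)^-1, (k%:~R + a)^-1]%classic /\
  [\/ a = 0 /\ b = 1 / 2, a = - (1 / 2) /\ b = 0 | a = - (1 / 2) /\ b = 1 / 2].
Proof.
move=> k2.
have h0 : - (1 / 2) <= 0 :> R by lra.
have h1 : 0 <= 1 / 2 :> R by lra.
have h2 : - (1 / 2) <= 1 / 2 :> R by lra.
have [k2E|kN2] := eqVneq k 2.
  exists 0, (1 / 2); split; last by constructor 1.
  rewrite k2E; apply: digit_cylinder_itv => //; first by left; lra.
  move=> y /andP[y1 ->]; rewrite andbT ger0_norm; last lra.
  by rewrite lerDl.
have [k2E|kNN2] := eqVneq k (- 2).
  exists (- (1 / 2)), 0; split; last by constructor 2.
  rewrite k2E; apply: digit_cylinder_itv => //; first by right; lra.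
  move=> y /andP[-> y2]; rewrite ler0_norm; last lra.
  by rewrite opprD opprK lerDl oppr_ge0.
exists (- (1 / 2)), (1 / 2); split; last by constructor 3.
have k3 : (3 <= k%:~R :> R) \/ (k%:~R <= -3 :> R).
  have [kp|kn] := leP 0 k; [left|right].
    rewrite ger0_norm// in k2; rewrite (_ : 3 = (3 : int)%:~R)// ler_int.
    by rewrite (_ : 3 = 2 + 1)// lezD1 lt_neqAle eq_sym kN2.
  rewrite ltr0_norm// lerNr in k2; rewrite (_ : -3 = (-3 : int)%:~R)// ler_int.
  rewrite (_ : -3 = -2 - 1)// lerBrDr lezD1 lt_neqAle kNN2; exact: k2.
apply: digit_cylinder_itv => //; first by case: k3 => ?; [left|right]; lra.
move=> y /andP[y1 y2]; rewrite y1 y2; apply/idP; rewrite ler_normr; apply/orP.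
by case: k3 => ?; [left|right]; lra.
Qed.

Lemma digit_cylinder_gt0 k x : 2 <= k -> @digit_cylinder R k x -> 0 < x.
Proof.
rewrite -(ler_int R) => k2 [[y]]; rewrite /I_o /= in_itv/= => /andP[y1 y2] <- _.
by rewrite divr_gt0//; lra.
Qed.

Lemma digit_cylinder_lt0 k x : k <= - 2 -> @digit_cylinder R k x -> x < 0.
Proof.
rewrite -(ler_int R) mulrNz => k2 [[y]]; rewrite /I_o /= in_itv/= => /andP[y1 y2] <- _.
by rewrite div1r invr_lt0; lra.
Qed.

(** Intersecting with [I_o] makes the recursion start correctly: the cylinder of the empty word is
    the whole line. *)
Lemma cylinder_cons k (b : seq int) :
  @I_o R `&` cylinder (k :: b) = digit_cylinder k `&` T @^-1` (@I_o R `&` cylinder b).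
Proof.
apply/seteqP; split => x.
  move=> [Ix Cx]; split; first by have [] := Cx 0%N isT.
  split; first exact: T_o_I_o.
  move=> i ib; have [_ +] := Cx i.+1 ib; rewrite /preimage/= -iterS iterSr => h.
  by split => //; exact: T_o_I_o.
move=> [kx [_ Cx]]; have Ix : @I_o R x by have [] := kx.
split=> // -[|i] ib; first by split.
have [_ +] := Cx i ib; rewrite /preimage/= -iterSr.
by split.
Qed.

Lemma measurable_cylinder (b : seq int) : all (fun c : int => 2 <= `|c|) b ->
  measurable (@I_o R `&` cylinder b).
Proof.
elim: b => [_|c b IH /andP[c2 /IH mb]].
  by rewrite (_ : cylinder _ = setT) ?setIT; [exact: measurable_I_o|apply/seteqP; split].
rewrite cylinder_cons; apply: measurableI; last exact: (@measurable_preimage_T_o _ 1).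
by have [a [d [-> _]]] := digit_cylinder_cases c2; exact: measurable_itv.
Qed.

Lemma decays_digit k S : 2 <= `|k| -> measurable S ->
  decays (J `&` S) -> decays (J' `&` S) -> decays (digit_cylinder k `&` T @^-1` S).
Proof.
move=> k2 mS dS dS'.
have h0 : - (1 / 2) <= 0 :> R by lra.
have h1 : 0 <= 1 / 2 :> R by lra.
have [a [b [-> ab]]] := digit_cylinder_cases k2.
case: ab => -[-> ->]; apply: decays_branch => //; [lra|].
by apply: (decays_split (b := 0)) => //; lra.
Qed.

(** The two halves are carried separately because a preceding digit 2 or -2 sees only one of them. A
    cylinder with first digit [c] lies strictly on one side of 0, so its other half is empty. *)
Lemma decays_cylinder (b : seq int) : all (fun c : int => 2 <= `|c|) b ->
  decays (J `&` (@I_o R `&` cylinder b)) /\ decays (J' `&` (@I_o R `&` cylinder b)).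
Proof.
elim: b => [_|c b IH /andP[c2 b2]].
  rewrite (_ : cylinder _ = setT) ?setIT; last by apply/seteqP; split.
  have JI : J `<=` I_o.
    by move=> x; rewrite /I_o /= !in_itv/= => /andP[x0 ->]; rewrite (le_trans _ x0).
  have J'I : J' `<=` I_o.
    by move=> x; rewrite /I_o /= !in_itv/= => /andP[-> x0]; rewrite (le_trans x0).
  by rewrite !setIidl//; split; [exact: decays_right|exact: decays_left].
have [dJ dJ'] := IH b2; have mb := measurable_cylinder b2.
have dc := decays_digit c2 mb dJ dJ'.
rewrite cylinder_cons; set D := _ `&` T @^-1` _ in dc *.
have DI x : D x -> - (1 / 2) <= x <= 1 / 2.
  by move=> [[_]]; rewrite /I_o /= in_itv.
have [c0|c0] := leP 0 c.
  rewrite ger0_norm// in c2.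
  have Dgt x : D x -> 0 < x by move=> [+ _]; exact: digit_cylinder_gt0.
  rewrite setIidr; last first.
    by move=> x Dx; rewrite /= in_itv/= (ltW (Dgt _ Dx)); have /andP[] := DI _ Dx.
  rewrite (_ : J' `&` D = set0); first by split => //; exact: decays0.
  rewrite -subset0 => x [+ /Dgt]; rewrite /= in_itv/= => /andP[_ x0] x1.
  by move: (lt_le_trans x1 x0); rewrite ltxx.
rewrite ltr0_norm// lerNr in c2.
have Dlt x : D x -> x < 0 by move=> [+ _]; exact: digit_cylinder_lt0.
rewrite [J' `&` _]setIidr; last first.
  by move=> x Dx; rewrite /= in_itv/= (ltW (Dlt _ Dx)) andbT; have /andP[] := DI _ Dx.
rewrite (_ : J `&` D = set0); first by split => //; exact: decays0.
rewrite -subset0 => x [+ /Dlt]; rewrite /= in_itv/= => /andP[x0 _] x1.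
by move: (lt_le_trans x1 x0); rewrite ltxx.
Qed.

End cylinders.

Theorem corollary2 (R : realType) (F : set R) (hF : is_cylinder F) :
  exists2 C : R, 0 < C &
    forall (n : nat) (E : set R), (1 <= n)%N ->
      measurable E -> E `<=` I_o -> -%R @` E = E ->
      (`| mu_o (preim_T_o n E `&` F) - mu_o E * mu_o F |
         <= (C * (288 / 1000) ^+ n)%:E)%E.
Proof.
have [b /and3P[b0 b2 _] FE] := hF.
have [dJ dJ'] := @decays_cylinder R b b2.
have mF := @measurable_cylinder R b b2.
have h0 : - (1 / 2) <= 0 :> R by lra.
have h1 : 0 <= 1 / 2 :> R by lra.
have h2 : -1 <= - (1 / 2) :> R by lra.
have h3 : 1 / 2 <= 1 :> R by lra.
have dF := decays_split h2 h0 h1 h3 mF dJ' dJ.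
have [C C0 dec] := dF _ (@lip_density_o R) (@density_o_ge0_unit R).
(* The decay constant may be 0, and 1 is added to make it positive. *)
exists (C + 1) => [|n E _ mE _ symE]; first by rewrite ltr_wpDl.
have sE : symmetric_set E by move=> x Ex; rewrite -symE; exists x.
have IF : `[- (1 / 2), 1 / 2]%classic `&` (@I_o R `&` cylinder b) = @I_o R `&` F.
  by rewrite FE setIA setIid.
rewrite IF -FE in dec mF.
have e1 : @I_o R `&` (preim_T_o n E `&` F) = @I_o R `&` F `&` iter n T_o @^-1` E.
  by rewrite /preim_T_o !setIA setIid setIAC.
have mT : measurable (@I_o R `&` F `&` iter n T_o @^-1` E).
  by apply: measurableI => //; exact: measurable_preimage_T_o.
rewrite (mu_oE (A := preim_T_o n E `&` F)) ?e1// (mu_oE (A := F))//.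
have -> : mu_o E = (fine (mu_o E))%:E by rewrite mu_o_symmetric.
rewrite -EFinM -EFinB abse_EFin lee_fin.
apply: le_trans (dec n E mE sE) _.
have qn0 : 0 <= @contraction_rate R ^+ n by exact: exprn_ge0 (ltW contraction_rate_gt0).
by rewrite -[288 / 1000]/(@contraction_rate R) mulrDl mul1r lerDl.
Qed.
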